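(* A submanifold $N$ of a hyperkähler manifold $(M,g,I,J,K)$ is a complex-Lagrangian submanifold of $(M,I,\Omega_1)$ if and only if it is an imaginary-symplectic form of $(M,J,\Omega_2)$ and a real-symplectic form of $(M,K,\Omega_3)$.
   Context: A hyperkähler manifold is a Riemannian manifold $(M,g)$ with complex structures $I,J,K$ satisfying the quaternionic relations, Kähler with respect to each. Put $\omega_1(X,Y)=g(I(X),Y)$, $\omega_2(X,Y)=g(J(X),Y)$, $\omega_3(X,Y)=g(K(X),Y)$; then $\Omega_1=\omega_2+i\omega_3$, $\Omega_2=\omega_3+i\omega_1$, $\Omega_3=\omega_1+i\omega_2$ are holomorphic symplectic forms with respect to $I$, $J$, $K$ respectively. For a holomorphic symplectic manifold $(M,I',\Omega)$ (with complex structure $I'$), a real form is a submanifold $N$ with $T_xN\cap I'(T_xN)=\{0\}$ for all $x\in N$ and half the real dimension of $M$; it is a real-symplectic (imaginary-symplectic) form if $\Omega|_N$ is purely real (purely imaginary). A complex-Lagrangian submanifold is a complex submanifold of half dimension on which $\Omega$ vanishes. *)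

(* Defs.v *)
From HB Require Import structures.
From mathcomp Require Import all_boot all_order all_algebra.
From mathcomp Require Import all_classical all_reals all_analysis.
From mathcomp Require Import complex.

Set Implicit Arguments.
Unset Strict Implicit.
Unset Printing Implicit Defensive.

Import Order.TTheory GRing.Theory Num.Theory.
Import numFieldNormedType.Exports.

Local Open Scope classical_set_scope.
Local Open Scope ring_scope.

(* For an open set U of a finite-dimensional space this is the usual C^k class
   (iterated directional derivatives exist and are continuous). *)
Fixpoint Ck (R : realType) (V W : normedModType R) (k : nat)
    (U : set V) (f : V -> W) : Prop :=
  match k with
  | 0 => forall x, U x -> {for x, continuous f}
  | k'.+1 => (forall x, U x -> differentiable f x) /\
             (forall v, Ck k' U (fun x => 'D_v f x))
  end.

Definition smooth (R : realType) (V W : normedModType R)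
    (U : set V) (f : V -> W) : Prop := forall k, Ck k U f.

(* A homeomorphism from the open set [dom] onto an open set of R^n, with
   inverse [pt]; the values of [coord] and [pt] elsewhere are irrelevant. *)
Record chart (R : realType) (n : nat) (M : topologicalType) := Chart {
  dom : set M;
  coord : M -> 'cV[R]_n;
  pt : 'cV[R]_n -> M;
  dom_open : open dom;
  coord_open : open (coord @` dom);
  coordK : forall x, dom x -> pt (coord x) = x;
  coord_continuous : forall x, dom x -> {for x, continuous coord};
  pt_continuous : forall u, (coord @` dom) u -> {for u, continuous pt} }.

Section Charts.
Context (R : realType) (n : nat) (M : topologicalType).
Implicit Types c : chart R n M.

Definition codom c : set 'cV[R]_n := coord c @` dom c.

Definition transition c c' (u : 'cV[R]_n) : 'cV[R]_n := coord c' (pt c u).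

Definition compatible c c' : Prop :=
  smooth (coord c @` (dom c `&` dom c')) (transition c c') /\
  smooth (coord c' @` (dom c `&` dom c')) (transition c' c).

(* A tangent vector of M at x is represented in each chart c around x by its
   component vector; [dtransition] converts components from c to c'. *)
Definition dtransition c c' (x : M) (v : 'cV[R]_n) : 'cV[R]_n :=
  'D_v (transition c c') (coord c x).

End Charts.

Record manifold (R : realType) (n : nat) := Manifold {
  space :> topologicalType;
  space_hausdorff : hausdorff_space space;
  space_second_countable : @second_countable space;
  atlas : set (chart R n space);
  atlas_cover : forall x : space, exists2 c, atlas c & dom c x;
  atlas_compatible : forall c c', atlas c -> atlas c' -> compatible c c';
  atlas_maximal : forall c, (forall c', atlas c' -> compatible c c') -> atlas c }.

Definition chart_at (R : realType) (n : nat) (M : manifold R n) (x : M)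
    (c : chart R n M) : Prop := atlas c /\ dom c x.

(* Components of a tensor field with two indices: in the chart c, at x. *)
Definition components (R : realType) (n : nat) (M : manifold R n) : Type :=
  chart R n M -> M -> 'M[R]_n.

Section Tensors.
Context (R : realType) (n : nat) (M : manifold R n).
Implicit Types (A B C : components M) (c : chart R n M).

Definition smooth_components A : Prop :=
  forall c, atlas c -> smooth (codom c) (fun u => A c (pt c u)).

(* A is a smooth section of End(TM), acting by v |-> A c x *m v. *)
Definition endomorphism_field A : Prop :=
  smooth_components A /\
  forall x c c', chart_at x c -> chart_at x c' -> forall v,
    dtransition c c' x (A c x *m v) = A c' x *m dtransition c c' x v.

(* The value on (v, w) of the bilinear form field with components A. *)
Definition form A c (x : M) (v w : 'cV[R]_n) : R :=
  (v^T *m A c x *m w) 0 0.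

Definition bilinear_field A : Prop :=
  smooth_components A /\
  forall x c c', chart_at x c -> chart_at x c' -> forall v w,
    form A c' x (dtransition c c' x v) (dtransition c c' x w) = form A c x v w.

Definition riemannian_metric A : Prop :=
  bilinear_field A /\
  forall x c, chart_at x c ->
    (forall v w, form A c x v w = form A c x w v) /\
    (forall v, v != 0 -> 0 < form A c x v v).

Definition almost_complex A : Prop :=
  endomorphism_field A /\
  forall x c, chart_at x c -> A c x *m A c x = - 1%:M.

(* Multiplication by i on C^(n/2), with real coordinates ordered as
   Re z_0, Im z_0, Re z_1, Im z_1, ... *)
Definition standard_complex : 'M[R]_n :=
  \matrix_(i < n, j < n)
    if odd j then (if (i.+1 == j)%N then -1 else 0)
    else (if (i == j.+1 :> nat)%N then 1 else 0).

Definition holomorphic_chart A c : Prop :=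
  atlas c /\ forall x, dom c x -> A c x = standard_complex.

(* Integrability: M is covered by holomorphic coordinate charts. *)
Definition complex_structure A : Prop :=
  almost_complex A /\
  forall x : M, exists2 c, holomorphic_chart A c & dom c x.

Variable G : components M.

(* The form (X, Y) |-> g(A X, Y). *)
Definition fundamental_form A : components M :=
  fun c x => (A c x)^T *m G c x.

(* dB = 0, evaluated on constant (hence commuting) coordinate vector fields. *)
Definition closed_form B : Prop :=
  forall c, atlas c -> forall u, codom c u -> forall v1 v2 v3,
    'D_v1 (fun u' => form B c (pt c u') v2 v3 : R^o) u
    - 'D_v2 (fun u' => form B c (pt c u') v1 v3 : R^o) u
    + 'D_v3 (fun u' => form B c (pt c u') v1 v2 : R^o) u = 0.

Definition kahler A : Prop :=
  [/\ complex_structure A,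
      (forall x c, chart_at x c -> forall v w,
         form G c x (A c x *m v) (A c x *m w) = form G c x v w) &
      closed_form (fundamental_form A)].

End Tensors.

Record hyperkahler (R : realType) (n : nat) := Hyperkahler {
  hk_manifold :> manifold R n;
  hk_g : components hk_manifold;
  hk_I : components hk_manifold;
  hk_J : components hk_manifold;
  hk_K : components hk_manifold;
  hk_metric : riemannian_metric hk_g;
  hk_kahlerI : kahler hk_g hk_I;
  hk_kahlerJ : kahler hk_g hk_J;
  hk_kahlerK : kahler hk_g hk_K;
  (* with I^2 = J^2 = K^2 = -1, which is part of [kahler] *)
  hk_quaternionic : forall x c, chart_at x c ->
    hk_I c x *m hk_J c x = hk_K c x }.

Arguments hk_g {R n} h.
Arguments hk_I {R n} h.
Arguments hk_J {R n} h.
Arguments hk_K {R n} h.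

(* Complex-valued 2-forms: chart, point, and components of two vectors. *)
Definition complex_form (R : realType) (n : nat) (M : manifold R n) : Type :=
  chart R n M -> M -> 'cV[R]_n -> 'cV[R]_n -> R[i]%C.

Section HyperkahlerForms.
Context (R : realType) (n : nat) (M : hyperkahler R n).

Definition omega1 := fundamental_form (hk_g M) (hk_I M).
Definition omega2 := fundamental_form (hk_g M) (hk_J M).
Definition omega3 := fundamental_form (hk_g M) (hk_K M).

Definition Omega1 : complex_form M := fun c x v w =>
  (form omega2 c x v w +i* form omega3 c x v w)%C.
Definition Omega2 : complex_form M := fun c x v w =>
  (form omega3 c x v w +i* form omega1 c x v w)%C.
Definition Omega3 : complex_form M := fun c x v w =>
  (form omega1 c x v w +i* form omega2 c x v w)%C.

End HyperkahlerForms.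

Arguments Omega1 {R n} M.
Arguments Omega2 {R n} M.
Arguments Omega3 {R n} M.

Section Submanifolds.
Context (R : realType) (n : nat) (M : manifold R n).
Implicit Types (N : set M) (k : nat) (c : chart R n M).

Definition adapted_chart N k c : Prop :=
  forall y, dom c y -> (N y <-> forall i : 'I_n, (k <= i)%N -> coord c y i 0 = 0).

(* N is an embedded submanifold of M of dimension k. *)
Definition submanifold N k : Prop :=
  (k <= n)%N /\
  forall x, N x -> exists2 c, chart_at x c & adapted_chart N k c.

(* T_xN in the chart c: velocities at time 0 of smooth curves in N through x. *)
Definition tangent_space N c (x : M) : set 'cV[R]_n :=
  [set v | exists gamma : R^o -> 'cV[R]_n, exists2 e : R, 0 < e &
     [/\ smooth (ball (0 : R^o) e) gamma,
         (forall t, ball (0 : R^o) e t -> codom c (gamma t) /\ N (pt c (gamma t))),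
         gamma 0 = coord c x & derive1 gamma 0 = v]].

(* N is locally a complex coordinate subspace C^d in holomorphic charts; k is
   the real dimension. *)
Definition complex_submanifold (A : components M) N k : Prop :=
  submanifold N k /\
  forall x, N x -> exists d c,
    [/\ k = d.*2, holomorphic_chart A c, dom c x & adapted_chart N k c].

Definition half_dimensional k : Prop := k.*2 = n.

Definition restriction_satisfies (P : R[i]%C -> Prop) (Omega : complex_form M) N
    : Prop :=
  forall x c, N x -> chart_at x c -> forall v w,
    tangent_space N c x v -> tangent_space N c x w -> P (Omega c x v w).

Definition real_form (A : components M) N k : Prop :=
  [/\ submanifold N k,
      (forall x c, N x -> chart_at x c ->
         tangent_space N c x `&` [set A c x *m v | v in tangent_space N c x]
         = [set 0]) &
      half_dimensional k].

Definition real_symplectic_form A (Omega : complex_form M) N k : Prop :=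
  real_form A N k /\
  restriction_satisfies (fun z => complex.Im z = 0) Omega N.

Definition imaginary_symplectic_form A (Omega : complex_form M) N k : Prop :=
  real_form A N k /\
  restriction_satisfies (fun z => complex.Re z = 0) Omega N.

Definition complex_lagrangian A (Omega : complex_form M) N k : Prop :=
  [/\ complex_submanifold A N k, half_dimensional k &
      restriction_satisfies (fun z => z = 0) Omega N].

End Submanifolds.

(* Main.v *)
(* Forward: if v = J w with v, w tangent to N, then g(v, v) = omega_2(w, v) = 0,
   so N is totally real for J, and likewise for K.
   Backward: omega_2 = omega_3 = 0 on T = T_xN with dim T = n/2 forces
   J T = T^perp, which contains K T; hence I T = J K T is contained in J J T = T.
   It remains to find holomorphic charts adapted to a submanifold with I-stable
   tangent spaces.  In a holomorphic chart, after a complex linear change of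
   coordinates, N is locally the graph w = F(z) of a smooth map over C^d (inverse
   function theorem); stability of the tangent spaces makes dF complex linear, so
   (z, w) |-> (z, w - F(z)) is again a holomorphic chart, and it flattens N.
   Everything is kept in R^n, writing P = [pid_mx k] for the projection onto the
   first k coordinates, to avoid casts between R^n and R^k x R^(n-k). *)
From HB Require Import structures.
From mathcomp Require Import all_boot all_order all_algebra.
From mathcomp Require Import all_classical all_reals all_analysis.
From mathcomp Require Import complex.
From mathcomp Require Import zify ring lra.
Require Import Defs.

Set Implicit Arguments.
Unset Strict Implicit.
Unset Printing Implicit Defensive.

Import Order.TTheory GRing.Theory Num.Theory.
Import numFieldNormedType.Exports.

Local Open Scope classical_set_scope.
Local Open Scope ring_scope.

(** * Calculus of C^k maps *)

Section Calculus.
Context (R : realType).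
Implicit Types V W : normedModType R.

(** The estimate is the little-o expansion of [f] at [x] with linear part [df], and a continuous
    linear part of such an expansion is unique. *)
Lemma is_diffI V W (f : V -> W) (x : V) (df : {linear V -> W}) :
  continuous df ->
  (forall e, 0 < e -> \forall y \near x,
     `|f y - f x - df (y - x)| <= e * `|y - x|) ->
  is_diff x f df.
Proof.
move=> cdf H.
have E : f \o shift x = cst (f x) + df +o_ (0 : V) id.
  apply/eqaddoP => e e0; have := H e e0.
  rewrite (near_shift 0 x); apply: filterS => h.
  by rewrite /= subr0 addrK opprD addrA.
have Dd := diff_unique cdf E.
by apply: DiffDef => //; apply/diff_locallyP; rewrite Dd.
Qed.

Lemma diff_eps V W (f : V -> W) (x : V) : differentiable f x ->
  forall e, 0 < e -> \forall y \near x,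
     `|f y - f x - 'd f x (y - x)| <= e * `|y - x|.
Proof.
move=> /diff_locally/eqaddoP H e e0; have := H e e0.
rewrite (near_shift 0 x); apply: filterS => h.
by rewrite /= subr0 addrK opprD addrA.
Qed.

Lemma near_eq_differentiable V W (f g : V -> W) (x : V) :
  {near x, f =1 g} -> differentiable f x -> differentiable g x.
Proof.
move=> fg df; suff /@ex_diff : is_diff x g ('d f x) by [].
apply: is_diffI => [|e e0]; first exact: diff_continuous.
 have := diff_eps df e0 => K; near=> y.
rewrite -(nbhs_singleton fg); have <- : f y = g y by near: y.
by near: y.
Unshelve. all: by end_near. Qed.

(** Since [U] is open, agreement on [U] is agreement near each of its points, so all directional
    derivatives agree on [U] too. The inductions below use this to replace a derivative by a formula
    that holds only on [U]. *)
Lemma near_eq_Ck V W k (U : set V) (f g : V -> W) : open U ->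
  (forall x, U x -> f x = g x) -> Ck k U f -> Ck k U g.
Proof.
move=> oU; elim: k f g => [|k IH] f g fg /=.
  move=> cf x Ux; rewrite /prop_for /continuous_at -fg//.
  apply: (cvg_trans _ (cf x Ux)); apply: near_eq_cvg.
  by have := open_nbhs_nbhs (conj oU Ux); apply: filterS => y /fg.
have nfg x : U x -> {near x, f =1 g}.
  by move=> Ux; have := open_nbhs_nbhs (conj oU Ux); apply: filterS => y /fg.
move=> [df Df]; split=> [x Ux|v].
  by apply: near_eq_differentiable (nfg x Ux) (df x Ux).
by apply: IH (Df v) => x Ux; apply: near_eq_derive; exact: nfg.
Qed.

Lemma CkS V W k (U : set V) (f : V -> W) : Ck k.+1 U f -> Ck k U f.
Proof.
elim: k f => [|k IH] f [df Df].
  by move=> x Ux; apply: differentiable_continuous; exact: df.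
by split=> // v; exact: IH.
Qed.

Lemma sub_Ck V W k (U U' : set V) (f : V -> W) :
  U' `<=` U -> Ck k U f -> Ck k U' f.
Proof.
move=> UU; elim: k f => [|k IH] f /=; first by move=> H x /UU /H.
by move=> [df Df]; split=> [x /UU /df//|v]; exact: IH.
Qed.

Lemma Ck_cst V W k (U : set V) (a : W) : Ck k U (fun=> a).
Proof.
elim: k a => [|k IH] a /=; first by move=> x _; exact: cst_continuous.
split=> [x _|v]; first exact: differentiable_cst.
have -> : (fun x : V => 'D_v (fun=> a) x) = (fun=> 0).
  by apply/funext => x; exact: derive_cst.
exact: IH.
Qed.

Lemma Ck_linear_comp V W (X : normedModType R) k (U : set V) (f : V -> W)
    (L : {linear W -> X}) : open U -> continuous L ->
  Ck k U f -> Ck k U (fun x => L (f x)).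
Proof.
move=> oU cL; elim: k f => [|k IH] f /=.
  by move=> cf x /cf cfx; apply: continuous_comp => //; exact: cL.
move=> [df Df]; split=> [x Ux|v].
  by apply: differentiable_comp; [exact: df|exact: linear_differentiable].
apply: near_eq_Ck (IH _ (Df v)) => // x Ux.
have dL := linear_differentiable (f x) cL.
rewrite [RHS]deriveE; last by apply: differentiable_comp => //; exact: df.
rewrite (diff_comp (df _ Ux) dL) /= deriveE; last exact: df.
by rewrite diff_lin.
Qed.

Lemma Ck_id V k (U : set V) : Ck k U id.
Proof.
case: k => [|k] /=; first by move=> x _; exact: cvg_id.
split=> [x _|v]; first exact: ex_diff.
have -> : (fun x : V => 'D_v id x) = (fun=> v).
  by apply/funext => x; exact: derive_id.
exact: Ck_cst.
Qed.

Lemma Ck_linear V W k (U : set V) (L : {linear V -> W}) : open U ->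
  continuous L -> Ck k U L.
Proof. by move=> oU cL; exact: (Ck_linear_comp oU cL (Ck_id k U)). Qed.

Lemma CkD V W k (U : set V) (f g : V -> W) : open U ->
  Ck k U f -> Ck k U g -> Ck k U (fun x => f x + g x).
Proof.
move=> oU; elim: k f g => [|k IH] f g /=.
  by move=> cf cg x Ux; apply: continuousD; [exact: cf|exact: cg].
move=> [df Df] [dg Dg]; split=> [x Ux|v].
  by apply: differentiableD; [exact: df|exact: dg].
apply: near_eq_Ck (IH _ _ (Df v) (Dg v)) => // x Ux.
by rewrite [RHS]deriveD//; apply: diff_derivable; [exact: df|exact: dg].
Qed.

Lemma Ck_sum V W k (U : set V) (I : Type) (r : seq I) (P : pred I)
    (f : I -> V -> W) : open U ->
  (forall i, P i -> Ck k U (f i)) -> Ck k U (fun x => \sum_(i <- r | P i) f i x).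
Proof.
move=> oU H; elim: r => [|i r IH].
  have -> : (fun x : V => \sum_(i <- [::] | P i) f i x) = (fun=> 0).
    by apply/funext => x; rewrite big_nil.
  exact: Ck_cst.
case Pi: (P i); under eq_fun do rewrite big_cons Pi; last by [].
by apply: CkD => //; exact: H.
Qed.

Lemma CkM V k (U : set V) (f g : V -> R) : open U ->
  Ck k U f -> Ck k U g -> Ck k U (fun x => f x * g x).
Proof.
move=> oU; elim: k f g => [|k IH] f g /=.
  by move=> cf cg x Ux; exact: continuousM (cf x Ux) (cg x Ux).
move=> cf cg; have [df Df] := cf; have [dg Dg] := cg; split=> [x Ux|v].
  by apply: differentiableM; [exact: df|exact: dg].
have H := CkD oU (IH _ _ (CkS cf) (Dg v)) (IH _ _ (CkS cg) (Df v)).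
apply: near_eq_Ck H => // x Ux.
by rewrite [RHS]deriveM//; apply: diff_derivable; [exact: df|exact: dg].
Qed.

(** The derivative of [1/f] is [-(1/f)^2] times that of [f], so the induction hypothesis for [1/f]
    itself gives the next order. *)
Lemma CkV V k (U : set V) (f : V -> R) : open U ->
  (forall x, U x -> f x != 0) -> Ck k U f -> Ck k U (fun x => (f x)^-1).
Proof.
move=> oU f0; elim: k => [|k IH] /=.
  by move=> cf x Ux; exact: continuousV (f0 x Ux) (cf x Ux).
move=> cf; have [df Df] := cf; split=> [x Ux|v].
  by apply: differentiableV; [exact: df|exact: f0].
have cVf := IH (CkS cf).
have H := CkM oU (Ck_cst k U (-1 : R)) (CkM oU (CkM oU cVf cVf) (Df v)).
apply: near_eq_Ck H => // x Ux.
rewrite [RHS]deriveV//; [|exact: f0|exact/diff_derivable/df].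
by rewrite scaleNr mulN1r expr2 invfM.
Qed.

Lemma Ck_prod V k (U : set V) (I : Type) (r : seq I) (P : pred I)
    (f : I -> V -> R) : open U ->
  (forall i, P i -> Ck k U (f i)) ->
  Ck k U (fun x => \prod_(i <- r | P i) f i x).
Proof.
move=> oU H; elim: r => [|i r IH].
  have -> : (fun x : V => \prod_(i <- [::] | P i) f i x) = (fun=> 1).
    by apply/funext => x; rewrite big_nil.
  exact: Ck_cst.
case Pi: (P i); under eq_fun do rewrite big_cons Pi; last by [].
by apply: CkM => //; exact: H.
Qed.

Lemma mx_linear_continuous m n V (L : {linear 'M[R]_(m, n) -> V}) :
  continuous L.
Proof.
have -> : (L : _ -> V) = \sum_i \sum_j (fun M => M i j *: L (delta_mx i j)).
  apply/funext => M; rewrite {1}(matrix_sum_delta M) linear_sum fct_sumE.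
  apply: eq_bigr => i _; rewrite linear_sum fct_sumE.
  by apply: eq_bigr => j _; rewrite linearZ.
move=> M.
have cD (f g : 'M[R]_(m, n) -> V) : {for M, continuous f} ->
    {for M, continuous g} -> {for M, continuous (f + g)}.
  exact: continuousD.
elim/big_ind: _ => [||i _]; [exact: cst_continuous|exact: cD|].
elim/big_ind: _ => [||j _]; [exact: cst_continuous|exact: cD|].
by apply: continuousZr_tmp; exact: matrix_normedtype.coord_continuous.
Qed.

Lemma Ck_mx V m n k (U : set V) (f : V -> 'M[R]_(m, n)) : open U ->
  (forall i j, Ck k U (fun x => f x i j)) -> Ck k U f.
Proof.
move=> oU H.
have -> : f = fun x => \sum_i \sum_j f x i j *: delta_mx i j.
  by apply/funext => x; rewrite -matrix_sum_delta.
apply: Ck_sum => // i _; apply: Ck_sum => // j _.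
have lin : linear (fun a : R => a *: (delta_mx i j : 'M[R]_(m, n))).
  by move=> a b c; rewrite scalerDl scalerA.
pose linM := GRing.isLinear.Build _ _ _ _ _ lin.
pose L : {linear R -> 'M[R]_(m, n)} :=
  HB.pack (fun a : R => a *: (delta_mx i j : 'M[R]_(m, n))) linM.
by apply: (@Ck_linear_comp _ _ _ _ _ _ L) => //; exact: scalel_continuous.
Qed.

Lemma Ck_coord V m n k (U : set V) (f : V -> 'M[R]_(m, n)) i j : open U ->
  Ck k U f -> Ck k U (fun x => f x i j).
Proof.
move=> oU.
have lin : scalar (fun M : 'M[R]_(m, n) => M i j).
  by move=> a b c; rewrite !mxE.
pose linM := GRing.isLinear.Build _ _ _ _ _ lin.
pose L : {linear 'M[R]_(m, n) -> R} :=
  HB.pack (fun M : 'M[R]_(m, n) => M i j) linM.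
apply: (@Ck_linear_comp _ _ _ _ _ _ L) => //.
exact: matrix_normedtype.coord_continuous.
Qed.

Lemma Ck_mulmx V m n p k (U : set V) (f : V -> 'M[R]_(m, n))
    (g : V -> 'M[R]_(n, p)) : open U ->
  Ck k U f -> Ck k U g -> Ck k U (fun x => f x *m g x).
Proof.
move=> oU cf cg; apply: Ck_mx => // i j; under eq_fun do rewrite mxE.
by apply: Ck_sum => // l _; apply: CkM => //; exact: Ck_coord.
Qed.

Lemma derive_colE n W (f : 'cV[R]_n -> W) x v : differentiable f x ->
  'D_v f x = \sum_i v i 0 *: 'D_(delta_mx i 0) f x.
Proof.
move=> df; rewrite deriveE// {1}(matrix_sum_delta v) linear_sum.
apply: eq_bigr => i _; rewrite big_ord1 linearZ /= deriveE//.
Qed.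

(** By the chain rule, D_v(g o f) is the sum over i of (D_v f)_i times (D_i g) o f. With [g]
    real-valued each term is a product of scalar functions, and the second factor falls under the
    induction hypothesis. *)
Lemma Ck_comp_scalar V n k (U : set V) (U' : set 'cV[R]_n)
    (f : V -> 'cV[R]_n) (g : 'cV[R]_n -> R) :
  open U -> open U' -> (forall x, U x -> U' (f x)) ->
  Ck k U f -> Ck k U' g -> Ck k U (fun x => g (f x)).
Proof.
move=> oU oU' fU; elim: k f g fU => [|k IH] f g fU.
  move=> cf cg x Ux; apply: continuous_comp; first exact: cf.
  exact/cg/fU.
move=> cf cg; have [df Df] := cf; have [dg Dg] := cg; split=> [x Ux|v].
  by apply: differentiable_comp; [exact: df|exact/dg/fU].
pose Dgf x := \sum_i ('D_v f x) i 0 * ('D_(delta_mx i 0) g (f x)).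
apply: (@near_eq_Ck _ _ _ _ Dgf) => //.
  move=> x Ux; rewrite [RHS]deriveE; last first.
    by apply: differentiable_comp; [exact: df|exact/dg/fU].
  rewrite (diff_comp (df _ Ux) (dg _ (fU _ Ux))) /= -(deriveE v (df _ Ux)).
  by rewrite -(deriveE _ (dg _ (fU _ Ux))) (derive_colE _ (dg _ (fU _ Ux))).
apply: Ck_sum => // i _; apply: CkM => //; first exact/Ck_coord/Df.
exact: IH fU (CkS cf) (Dg _).
Qed.

Lemma Ck_comp V m n p k (U : set V) (U' : set 'cV[R]_n)
    (f : V -> 'cV[R]_n) (g : 'cV[R]_n -> 'M[R]_(m, p)) :
  open U -> open U' -> (forall x, U x -> U' (f x)) ->
  Ck k U f -> Ck k U' g -> Ck k U (fun x => g (f x)).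
Proof.
move=> oU oU' fU cf cg; apply: Ck_mx => // i j.
by apply: (@Ck_comp_scalar _ _ _ _ U' f (fun y => g y i j)) => //; exact: Ck_coord.
Qed.

Lemma Ck_det V n k (U : set V) (f : V -> 'M[R]_n) : open U ->
  Ck k U f -> Ck k U (fun x => \det (f x)).
Proof.
move=> oU cf; apply: Ck_sum => // s _; apply: CkM => //; first exact: Ck_cst.
by apply: Ck_prod => // i _; exact: Ck_coord.
Qed.

Lemma Ck_invmx V n k (U : set V) (f : V -> 'M[R]_n) : open U ->
  (forall x, U x -> f x \in unitmx) ->
  Ck k U f -> Ck k U (fun x => invmx (f x)).
Proof.
move=> oU f0 cf; apply: Ck_mx => // i j.
(* Cramer's rule: the entries of the inverse are cofactors divided by the determinant. *)
pose g x := (\det (f x))^-1 * ((-1) ^+ (j + i) * \det (row' j (col' i (f x)))).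
apply: (@near_eq_Ck _ _ _ _ g) => //.
  by move=> x Ux; rewrite /invmx f0// !mxE.
apply: CkM => //.
  by apply: CkV => //; [move=> x /f0; rewrite unitmxE unitfE|exact: Ck_det].
apply: CkM => //; first exact: Ck_cst.
apply: Ck_det => //; apply: Ck_mx => // a b; under eq_fun do rewrite !mxE.
exact: Ck_coord.
Qed.

End Calculus.

(** * The inverse function theorem *)

(** Matrices as a complete normed module, the setting of the Banach fixed point theorem used in
    [near_id_inverse]. *)
HB.instance Definition _ (R : realType) m n := Complete.on 'M[R]_(m, n).

Section InverseFunction.
Context (R : realType).

Lemma normr_coord_le m n (M : 'M[R]_(m, n)) i j : `|M i j| <= `|M|.
Proof.
rewrite [leRHS]/Num.Def.normr/= mx_normrE.
exact: (le_bigmax _ (fun ij : 'I_m * 'I_n => `|M ij.1 ij.2|) (i, j)).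
Qed.

Lemma mx_norm_le m n (M : 'M[R]_(m, n)) (c : R) : 0 <= c ->
  (forall i j, `|M i j| <= c) -> `|M| <= c.
Proof.
move=> c0 H; rewrite [leLHS]/Num.Def.normr/= mx_normrE.
by apply: bigmax_le => // -[i j] _; exact: H.
Qed.

Lemma mx_norm_mulmx m n p (A : 'M[R]_(m, n)) (B : 'M[R]_(n, p)) :
  `|A *m B| <= n%:R * `|A| * `|B|.
Proof.
apply: mx_norm_le => [|i j]; first by rewrite !mulr_ge0.
rewrite mxE (le_trans (ler_norm_sum _ _ _))//.
have -> : n%:R * `|A| * `|B| = \sum_(l < n) `|A| * `|B|.
  by rewrite sumr_const card_ord -mulrA mulr_natl.
by apply: ler_sum => l _; rewrite normrM ler_pM ?normr_coord_le.
Qed.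

(** The mean value theorem applies to each entry of [f] along the segment from [y] to [x], which
    stays in the ball by convexity. Bounding entries suffices because the matrix norm is their
    maximum. *)
Lemma lipschitz_ball (V : normedModType R) m n (f : V -> 'M[R]_(m, n))
    (x0 : V) (r c : R) :
  (forall x, ball x0 r x -> differentiable f x) ->
  (forall x v, ball x0 r x -> `|'D_v f x| <= c * `|v|) ->
  forall x y, ball x0 r x -> ball x0 r y -> `|f x - f y| <= c * `|x - y|.
Proof.
move=> df Hc x y x0x x0y.
have c0 : 0 <= c * `|x - y| by apply: le_trans (Hc x (x - y) x0x).
apply: mx_norm_le => // i j; rewrite !mxE.
pose l (t : R) : V := y + t *: (x - y).
have bl (t : R) : 0 <= t <= 1 -> ball x0 r (l t).
  move=> /andP[t0 t1]; move: x0x x0y; rewrite -!ball_normE /ball_ /= => x0x x0y.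
  have -> : x0 - l t = (1 - t) *: (x0 - y) + t *: (x0 - x).
    have -> : x0 - x = (x0 - y) - (x - y) by rewrite opprB addrA subrK.
    by rewrite (scalerBr t) scalerBl scale1r addrA subrK /l opprD addrA.
  rewrite (le_lt_trans (ler_normD _ _))// !normrZ ger0_norm ?subr_ge0//.
  rewrite (ger0_norm t0).
  (* At [t = 0] the strict inequality has to come from [y], since multiplying by [t] destroys the
     one for [x]. *)
  have [t0'|t0'] := eqVneq t 0; first by rewrite t0' subr0 mul1r mul0r addr0.
  have : t * `|x0 - x| < t * r by rewrite ltr_pM2l // lt_def t0' t0.
  have : (1 - t) * `|x0 - y| <= (1 - t) * r by rewrite ler_wpM2l ?subr_ge0// ltW.
  lra.
have dl (t : R) : is_diff t l ( *:%R ^~ (x - y)).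
  rewrite -[X in is_diff _ _ X]add0r.
  exact: is_diffD.
have dfl (t : R) : 0 <= t <= 1 ->
    is_derive t 1 (fun t : R => f (l t) i j : R) ('D_(x - y) f (l t) i j).
  move=> t01; have dflt := df _ (bl _ t01).
  have D1 : differentiable (f \o l) t by apply: differentiable_comp.
  have D2 : derivable (f \o l) t 1 by exact: diff_derivable.
  apply: DeriveDef; first by have /derivable_mxP := D2; apply.
  have := derive_mx D2; rewrite deriveE// diff_comp//= diff_val scale1r.
  by rewrite -deriveE// => ->; rewrite mxE.
have [||t t01] := @MVT R (fun t => f (l t) i j)
    (fun t => 'D_(x - y) f (l t) i j) 0 1 ltr01.
- by move=> t; rewrite in_itv /= => /andP[t0 t1]; apply: dfl; rewrite !ltW.
- apply: derivable_within_continuous => t; rewrite in_itv /= => t01.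
  by have [] := dfl _ t01.
rewrite /l scale0r addr0 scale1r [y + _]addrC subrK subr0 mulr1 => ->.
apply: le_trans (normr_coord_le _ _ _) (Hc _ _ _).
by apply: bl; move: t01; rewrite in_itv /= => /andP[/ltW -> /ltW ->].
Qed.

(** * Jacobian matrices *)

Definition jac n m (f : 'cV[R]_n -> 'cV[R]_m) (x : 'cV[R]_n) : 'M[R]_(m, n) :=
  \matrix_(i, j) 'D_(delta_mx j 0) f x i 0.

Lemma jacE n m (f : 'cV[R]_n -> 'cV[R]_m) x v :
  differentiable f x -> 'D_v f x = jac f x *m v.
Proof.
move=> df; rewrite derive_colE//; apply/matrixP => i j.
rewrite summxE mxE; apply: eq_bigr => l _.
by rewrite ord1 !mxE mulrC.
Qed.

Lemma jac_eq n m (f : 'cV[R]_n -> 'cV[R]_m) (A : 'M[R]_(m, n)) x :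
  (forall v, 'D_v f x = A *m v) -> jac f x = A.
Proof.
by move=> H; apply/matrixP => i j; rewrite mxE H -colE mxE.
Qed.

Lemma Ck_jac n m k U (f : 'cV[R]_n -> 'cV[R]_m) : open U ->
  Ck k.+1 U f -> Ck k U (jac f).
Proof.
move=> oU [_ Df]; apply: Ck_mx => // i j; under eq_fun do rewrite mxE.
exact/Ck_coord/Df.
Qed.

Lemma unitmx_inj n (A : 'M[R]_n) :
  (forall v : 'cV_n, A *m v = 0 -> v = 0) -> A \in unitmx.
Proof.
move=> H; rewrite -unitmx_tr -row_free_unit; apply: inj_row_free => v Hv.
by apply: trmx_inj; rewrite trmx0; apply: H; rewrite -[A]trmxK -trmx_mul Hv trmx0.
Qed.

Lemma jac_comp n m p (f : 'cV[R]_n -> 'cV[R]_m) (g : 'cV[R]_m -> 'cV[R]_p) x :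
  differentiable f x -> differentiable g (f x) ->
  jac (fun y => g (f y)) x = jac g (f x) *m jac f x.
Proof.
move=> df dg; apply: jac_eq => v.
rewrite deriveE; last exact: differentiable_comp.
by rewrite (diff_comp df dg) /= -(deriveE _ df) -(deriveE _ dg) !jacE// mulmxA.
Qed.

Lemma mulmx_continuous n m (A : 'M[R]_(m, n)) :
  continuous (mulmx A : 'cV[R]_n -> 'cV[R]_m).
Proof. exact: (mx_linear_continuous (L := mulmx A)). Qed.

Lemma differentiable_mulmx n m (A : 'M[R]_(m, n)) (x : 'cV[R]_n) :
  differentiable (mulmx A) x.
Proof.
apply: (linear_differentiable (f := mulmx A)).
exact: mulmx_continuous.
Qed.

Lemma jac_mulmx n m (A : 'M[R]_(m, n)) x : jac (mulmx A) x = A.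
Proof.
apply: jac_eq => v; rewrite deriveE; last exact: differentiable_mulmx.
by rewrite (diff_lin (f := mulmx A))//; exact: mulmx_continuous.
Qed.

Lemma Ck_mulmxl (V : normedModType R) n m p k (U : set V) (A : 'M[R]_(m, n))
    (f : V -> 'M[R]_(n, p)) :
  open U -> Ck k U f -> Ck k U (fun x => A *m f x).
Proof. by move=> oU; apply: Ck_mulmx => //; exact: Ck_cst. Qed.

Lemma near_eq_jac n m (f g : 'cV[R]_n -> 'cV[R]_m) x (U : set 'cV[R]_n) :
  open U -> U x -> (forall y, U y -> f y = g y) -> jac f x = jac g x.
Proof.
move=> oU Ux fg; apply/matrixP => i j; rewrite !mxE.
rewrite (near_eq_derive (g := g))//.
by apply: filterS (open_nbhs_nbhs (conj oU Ux)) => y /fg.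
Qed.

Lemma jac_left_inverse n (f g : 'cV[R]_n -> 'cV[R]_n) (U : set 'cV[R]_n) x :
  open U -> U x -> (forall y, U y -> g (f y) = y) ->
  differentiable f x -> differentiable g (f x) ->
  jac g (f x) *m jac f x = 1%:M.
Proof.
move=> oU Ux gf df dg; rewrite -jac_comp//.
rewrite (near_eq_jac (g := id) oU Ux)//.
by apply: jac_eq => v; rewrite mul1mx derive_id.
Qed.

Lemma open_setI_preimage (S T : topologicalType) (f : S -> T) (A : set S)
    (B : set T) :
  open A -> open B -> (forall x, A x -> {for x, continuous f}) ->
  open (A `&` f @^-1` B).
Proof.
move=> oA oB cf; rewrite openE => x [Ax Bx]; apply: filterI.
  exact: open_nbhs_nbhs.
exact: (cf x Ax) _ (open_nbhs_nbhs (conj oB Bx)).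
Qed.

Lemma smooth_continuous (V W : normedModType R) (U : set V) (f : V -> W) x :
  smooth U f -> U x -> {for x, continuous f}.
Proof. by move=> sf; exact: (sf 0). Qed.

Lemma smooth_differentiable (V W : normedModType R) (U : set V) (f : V -> W) x :
  smooth U f -> U x -> differentiable f x.
Proof. by move=> sf; exact: (sf 1).1. Qed.

Lemma jacD n m (f g : 'cV[R]_n -> 'cV[R]_m) x :
  differentiable f x -> differentiable g x ->
  jac (fun y => f y + g y) x = jac f x + jac g x.
Proof.
move=> df dg; apply: jac_eq => v.
by rewrite deriveD ?mulmxDl ?jacE//; exact: diff_derivable.
Qed.

Lemma differentiable_mulmxl n m p (A : 'M[R]_(p, m)) (f : 'cV[R]_n -> 'cV[R]_m) x :
  differentiable f x -> differentiable (fun y => A *m f y) x.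
Proof.
by move=> df; apply: differentiable_comp => //; exact: differentiable_mulmx.
Qed.

Lemma jac_mulmxl n m p (A : 'M[R]_(p, m)) (f : 'cV[R]_n -> 'cV[R]_m) x :
  differentiable f x -> jac (fun y => A *m f y) x = A *m jac f x.
Proof.
move=> df; rewrite (jac_comp df (differentiable_mulmx A (f x))).
by rewrite jac_mulmx.
Qed.

(** The Lipschitz bound makes [h] continuous and turns the first-order expansion of [f] into one of
    [h]. Smoothness then bootstraps: the derivative of [h] is [invmx (jac f (h y))], which is C^k as
    soon as [h] is. *)
Lemma smooth_inverse n (f h : 'cV[R]_n -> 'cV[R]_n) (W V : set 'cV[R]_n) :
  open W -> open V -> smooth W f ->
  (forall x, W x -> jac f x \in unitmx) ->
  (forall y, V y -> W (h y) /\ f (h y) = y) ->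
  (forall y y', V y -> V y' -> `|h y - h y'| <= 2 * `|y - y'|) ->
  (forall y, V y -> differentiable h y /\
     forall v, 'D_v h y = invmx (jac f (h y)) *m v) /\
  smooth V h.
Proof.
move=> oW oV sf uf hV lh.
have ch y : V y -> {for y, continuous h}.
  move=> Vy; apply/(@cvgrPdist_le _ _ _ _ (nbhs_filter y)) => e e0.
  have e2 : 0 < 2^-1 * e by rewrite mulr_gt0// invr_gt0.
  have Vy' := open_nbhs_nbhs (conj oV Vy).
  apply: filterS (filterI Vy' (nbhsx_ballx y _ e2)) => y' [Vy''].
  rewrite -ball_normE => /ltW yy'.
  by rewrite (le_trans (lh _ _ Vy Vy''))// -ler_pdivlMl.
have dh y : V y -> is_diff y h (mulmx (invmx (jac f (h y)))).
  move=> Vy; have [Wx fx] := hV _ Vy; set x := h y in Wx fx *.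
  have dfx : differentiable f x by have [+ _] := sf 1; apply.
  pose L := mulmx (invmx (jac f x)) : {linear 'cV[R]_n -> 'cV[R]_n}.
  have LE (z w : 'cV[R]_n) : z - L w = - L (w - jac f x *m z).
    by rewrite /L /= mulmxBr mulmxA mulVmx ?uf// mul1mx opprB.
  have cL : continuous L by exact: mx_linear_continuous.
  apply: (@is_diffI _ _ _ _ _ L) => // e e0.
  have [C C0 HC] := linear_lipschitz cL.
  (* [C] bounds the inverse differential [L] and [2] is the Lipschitz constant of [h]; their product
     cancels the denominator. *)
  have e'0 : 0 < e / (2 * C) by rewrite divr_gt0// mulr_gt0.
  have /(ch y Vy) K := diff_eps dfx e'0.
  have Vy' := open_nbhs_nbhs (conj oV Vy).
  apply: filterS (filterI Vy' K) => y' [Vy''].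
  have [Wx' fx'] := hV _ Vy''; set x' := h y' in Wx' fx' *.
  rewrite /= -/x' -(deriveE _ dfx) jacE// fx fx' => Hn.
  have -> : x' - x - L (y' - y) = - L (y' - y - jac f x *m (x' - x)).
    exact: LE.
  rewrite normrN (le_trans (HC _))//.
  have := lh _ _ Vy'' Vy; rewrite -/x -/x' => lhy.
  have := ler_wpM2l (ltW C0) Hn; move/le_trans; apply.
  rewrite mulrA [C * _]mulrC invfM mulrA mulfVK ?gt_eqF//.
  rewrite -mulrA ler_pM2l// ler_pdivrMl//.
have Dh y v : V y -> 'D_v h y = invmx (jac f (h y)) *m v.
  by move=> Vy; have [dhy E] := dh _ Vy; rewrite deriveE// E.
split=> [y Vy|]; first by split=> [|v]; [have [] := dh _ Vy|exact: Dh].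
elim=> [|k IH] /=; first exact: ch.
split=> [y Vy|v]; first by have [] := dh _ Vy.
apply: (@near_eq_Ck _ _ _ _ _ (fun y => invmx (jac f (h y)) *m v)) => //.
  by move=> y Vy; rewrite Dh.
apply: Ck_mulmx => //; last exact: Ck_cst.
apply: Ck_invmx => // [y Vy|]; first by apply: uf; have [] := hV _ Vy.
apply: (Ck_comp oV oW) => // [y /hV[]//|]; apply: Ck_jac => //; exact: sf.
Qed.

(** As [id - f] contracts by 1/2, distances satisfy |x - y| <= 2 |f x - f y|, which gives
    injectivity and the Lipschitz constant of [h]; solvability is a fixed point argument. The
    hypotheses are on radius 2r so that they cover the closed ball of radius r, which the fixed
    point theorem requires. *)
Lemma near_id_inverse n (f : 'cV[R]_n -> 'cV[R]_n) (x0 : 'cV[R]_n) (r : R) :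
  0 < r ->
  (forall x, ball x0 (r *+ 2) x -> {for x, continuous f}) ->
  (forall x y, ball x0 (r *+ 2) x -> ball x0 (r *+ 2) y ->
     `|(x - f x) - (y - f y)| <= 2^-1 * `|x - y|) ->
  exists h, let V := ball (f x0) (r / 2) in let W := ball x0 r `&` f @^-1` V in
   [/\ open W, (forall x, W x -> h (f x) = x),
      (forall y, V y -> W (h y) /\ f (h y) = y) &
      (forall y y', V y -> V y' -> `|h y - h y'| <= 2 * `|y - y'|)].
Proof.
move=> r0 cf Hf.
have r2 : r < r *+ 2 by rewrite mulr2n ltrDl.
have ballr x : `|x - x0| <= r -> ball x0 (r *+ 2) x.
  by move=> H; rewrite -ball_normE /ball_ /= distrC (le_lt_trans H).
have sballr x : ball x0 r x -> ball x0 (r *+ 2) x.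
  by apply: le_ball; rewrite ltW.
have lip x y : ball x0 (r *+ 2) x -> ball x0 (r *+ 2) y ->
    `|x - y| <= 2 * `|f x - f y|.
  move=> bx b_y; have H := Hf _ _ bx b_y.
  have : `|x - y| <= `|(x - f x) - (y - f y)| + `|f x - f y|.
    apply: le_trans (ler_normD _ _).
    rewrite [X in _ <= `|X|](_ : _ = x - y)//.
    by apply/matrixP => i j; rewrite !mxE; ring.
  lra.
have ex y : ball (f x0) (r / 2) y -> exists x, ball x0 r x /\ f x = y.
  rewrite -ball_normE /ball_ /= distrC => yr.
  pose B := [set x : 'cV[R]_n | `|x - x0| <= r].
  (* The solutions of f x = y are the fixed points of T. *)
  pose T x := x - f x + y.
  (* The contraction contributes at most r/2 and the distance from [y] to [f x0] less than r/2.
     Strictness puts the fixed point in the open ball. *)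
  have TB' x : B x -> `|T x - x0| < r.
    move=> Bx; have := Hf x x0 (ballr _ Bx) (sballr _ (ballxx _ r0)).
    have -> : T x - x0 = (x - f x - (x0 - f x0)) + (y - f x0).
      by apply/matrixP => i j; rewrite !mxE; ring.
    move=> H; rewrite (le_lt_trans (ler_normD _ _))//.
    move: Bx; rewrite /B /= => Bx; lra.
  have TB : set_fun B B T by move=> x Bx; rewrite /B /= ltW// TB'.
  pose TF : {fun B >-> B} := HB.pack T (isFun.Build _ _ _ _ T TB).
  have ctr : is_contraction TF.
    have q0 : (0 : R) <= 2^-1 by rewrite invr_ge0.
    exists (NngNum q0); split => /=; first by rewrite invf_lt1// ltr1n.
    move=> [u v] [/= Bu Bv]; rewrite /T opprD addrACA subrr addr0.
    exact: Hf (ballr _ Bu) (ballr _ Bv).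
  have clB : closed B.
    have -> : B = closed_ball_ Num.norm x0 r.
      by apply/funext => x; rewrite /closed_ball_ /B /= distrC.
    exact: closed_closed_ball_.
  have [p Bp pE] : exists2 p : 'cV[R]_n, B p & p = T p.
    have [|p Bp pE] := banach_fixed_point ctr clB; last by exists p.
    by exists x0; rewrite /B /= subrr normr0 ltW.
  exists p; split.
    by rewrite distrC pE; exact: TB'.
  apply/matrixP => i j; move/matrixP: pE => /(_ i j); rewrite /= !mxE.
  lra.
pose h y := get [set x | ball x0 r x /\ f x = y].
have hP y : ball (f x0) (r / 2) y -> ball x0 r (h y) /\ f (h y) = y.
  move=> /ex [x Hx].
  by apply: (@getPex _ [set x | ball x0 r x /\ f x = y]); exists x.
exists h => V W; split.
- rewrite openE => x [bx Vx]; apply: filterI.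
    by apply: open_nbhs_nbhs; split=> //; exact: ball_open.
  apply: cf; first exact: sballr.
  by apply: open_nbhs_nbhs; split=> //; apply: ball_open; rewrite divr_gt0.
- move=> x [bx Vx]; have [bh fh] := hP _ Vx.
  have := lip _ _ (sballr _ bh) (sballr _ bx); rewrite fh subrr normr0 mulr0.
  by rewrite normr_le0 subr_eq0 => /eqP.
- by move=> y Vy; have [bh fh] := hP _ Vy; split=> //; split=> //=; rewrite fh.
- move=> y y' Vy Vy'; have [bh fh] := hP _ Vy; have [bh' fh'] := hP _ Vy'.
  by have := lip _ _ (sballr _ bh) (sballr _ bh'); rewrite fh fh'.
Qed.

Lemma inverse_function_id n (f : 'cV[R]_n -> 'cV[R]_n) (U : set 'cV[R]_n)
    (x0 : 'cV[R]_n) :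
  open U -> smooth U f -> U x0 -> jac f x0 = 1%:M ->
  exists (W V : set 'cV[R]_n) (h : 'cV[R]_n -> 'cV[R]_n),
    [/\ open W, open V, W x0, W `<=` U &
     [/\ (forall x, W x -> V (f x) /\ h (f x) = x),
      (forall y, V y -> W (h y) /\ f (h y) = y) & smooth V h]].
Proof.
move=> oU sf Ux0 j1.
have cjf : {for x0, continuous (jac f)} by exact: (Ck_jac oU (sf 1)) Ux0.
(* [mx_norm_mulmx] costs a factor [n], and [n * c <= 1/2] is the contraction constant wanted; [n.+1]
   keeps the denominator nonzero when [n = 0]. *)
pose c : R := (2 * n.+1%:R)^-1.
have c0 : 0 < c by rewrite invr_gt0 mulr_gt0.
have Kc := cjf _ (nbhsx_ballx _ _ c0).
have : nbhs x0 (U `&` (jac f @^-1` ball (jac f x0) c)).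
  exact: filterI (open_nbhs_nbhs (conj oU Ux0)) Kc.
move=> /nbhs_ballP [r0 /= r00 Hr0].
pose r := r0 / 2.
have rgt0 : 0 < r by rewrite divr_gt0.
have r2E : r *+ 2 = r0 by rewrite -mulr_natr divfK.
have bU x : ball x0 (r *+ 2) x -> U x by rewrite r2E => /Hr0 [].
have df x : U x -> differentiable f x by have [+ _] := sf 1; apply.
have bj (x v : 'cV[R]_n) : ball x0 (r *+ 2) x -> `|v - jac f x *m v| <= 2^-1 * `|v|.
  rewrite r2E => /Hr0 [_]; rewrite /= j1 -ball_normE /= => H.
  have -> : v - jac f x *m v = (1%:M - jac f x) *m v.
    by rewrite mulmxBl mul1mx.
  rewrite (le_trans (mx_norm_mulmx _ _))// ler_wpM2r//.
  apply: le_trans (_ : n%:R * c <= _); first by rewrite ler_wpM2l// ltW.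
  rewrite /c invfM mulrCA -[leRHS]mulr1 ler_wpM2l ?invr_ge0//.
  by rewrite ler_pdivrMr// mul1r ler_nat.
have cf x : ball x0 (r *+ 2) x -> {for x, continuous f}.
  by move=> /bU Ux; apply: (sf 0).
have lipg : forall x y, ball x0 (r *+ 2) x -> ball x0 (r *+ 2) y ->
     `|(x - f x) - (y - f y)| <= 2^-1 * `|x - y|.
  pose g : 'cV[R]_n -> 'cV[R]_n := id - f.
  have dg x : ball x0 (r *+ 2) x ->
      is_diff x g (id - ('d f x : 'cV[R]_n -> 'cV[R]_n)).
    by move=> /bU/df/differentiableP dfx; exact: is_diffB.
  apply: (@lipschitz_ball _ _ _ g) => [x /dg[]//|x v bx].
  have [Dg Eg] := dg x bx; rewrite deriveE// Eg.
  rewrite -[X in `|X|]/(v - 'd f x v) -deriveE ?jacE; [|exact/df/bU..].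
  exact: bj.
have [h /= [oW hf fh lh]] := near_id_inverse rgt0 cf lipg.
set V := ball (f x0) (r / 2) in oW hf fh lh.
set W := ball x0 r `&` _ in oW hf fh lh.
have oV : open V by apply: ball_open; rewrite divr_gt0.
have bW x : W x -> ball x0 (r *+ 2) x.
  by move=> [bx _]; apply: le_ball bx; rewrite mulr2n lerDl ltW.
have WU : W `<=` U by move=> x /bW/bU.
exists W, V, h; split=> //.
  by split; [exact: ballxx|by apply: ballxx; rewrite divr_gt0].
split=> //; first by move=> x Wx; split; [have [] := Wx|exact: hf].
have uf x : W x -> jac f x \in unitmx.
  move=> /bW bx; apply: unitmx_inj => v Lv.
  have := bj x v bx; rewrite Lv subr0 => H.
  apply/eqP; rewrite -normr_le0; lra.
have [] := smooth_inverse oW oV _ uf fh lh => //.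
by move=> k; apply: sub_Ck (sf k).
Qed.

(** Composing with the inverse of the Jacobian at [x0] reduces to the case of identity Jacobian. *)
Theorem inverse_function n (f : 'cV[R]_n -> 'cV[R]_n) (U : set 'cV[R]_n)
    (x0 : 'cV[R]_n) :
  open U -> smooth U f -> U x0 -> jac f x0 \in unitmx ->
  exists (W V : set 'cV[R]_n) (h : 'cV[R]_n -> 'cV[R]_n),
    [/\ open W, open V, W x0, W `<=` U &
     [/\ (forall x, W x -> V (f x) /\ h (f x) = x),
      (forall y, V y -> W (h y) /\ f (h y) = y) & smooth V h]].
Proof.
move=> oU sf Ux0 uA; set A := jac f x0 in uA.
pose g x := invmx A *m f x.
have sg : smooth U g by move=> k; exact: Ck_mulmxl.
have jg : jac g x0 = 1%:M.
  by rewrite jac_mulmxl ?mulVmx//; exact: smooth_differentiable sf Ux0.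
have [W [V [h [oW oV Wx0 WU [hg gh sh]]]]] := inverse_function_id oU sg Ux0 jg.
pose V' := mulmx (invmx A) @^-1` V.
have oV' : open V' by apply: open_comp => // x _; exact: mulmx_continuous.
exists W, V', (fun y => h (invmx A *m y)); split=> //; split=> //.
- move=> y /gh [Wy gy]; split=> //.
  by have := congr1 (mulmx A) gy; rewrite /g !mulKVmx.
- move=> k; apply: (@Ck_comp R _ n n 1 k V' V (mulmx (invmx A)) h) => //.
  exact/Ck_mulmxl/Ck_id.
Qed.

End InverseFunction.

(** * Linear algebra *)

Section LinearAlgebra.
Context (R : realType).

Lemma pid_mx_idem n k :
  (pid_mx k : 'M[R]_n) *m (pid_mx k : 'M[R]_n) = pid_mx k :> 'M[R]_n.
Proof. by rewrite mul_pid_mx minnn -[RHS]pid_mx_minv minnC. Qed.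

(** Here T is the column space of [P], and the conclusion says that [I] preserves T. Matrix spaces
    are row spaces, so J T appears as [P *m J^T] and the orthogonal of T as [kermx (G *m P)]. *)
Lemma lagrangian_invariant n k (G I J K : 'M[R]_n) :
  let P : 'M[R]_n := pid_mx k in
  (k <= n)%N -> k.*2 = n ->
  (forall v : 'cV_n, v != 0 -> 0 < (v^T *m G *m v) 0 0) ->
  I *m I = - 1%:M -> J *m J = - 1%:M -> K *m K = - 1%:M -> I *m J = K ->
  P *m (J^T *m G) *m P = 0 -> P *m (K^T *m G) *m P = 0 ->
  P *m (I *m P) = I *m P.
Proof.
move=> P kn k2 Gpos II JJ KK IJ oJ oK.
have uG : G \in unitmx.
  apply: unitmx_inj => v Gv; apply/eqP; apply: contraT => /Gpos.
  by rewrite -mulmxA Gv mulmx0 mxE ltxx.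
have uJ : J \in unitmx.
  apply: unitmx_inj => v Jv; have := congr1 (fun M : 'M[R]_n => M *m v) JJ.
  by rewrite /= -mulmxA Jv mulmx0 mulNmx mul1mx => /eqP;
    rewrite eq_sym oppr_eq0 => /eqP.
have rP : \rank P = k by rewrite rank_pid_mx.
have PT : P^T = P by rewrite tr_pid_mx.
have rGP : \rank (G *m P) = k by rewrite (eqmxMfull _ _) ?row_full_unit.
have rJ : \rank (P *m J^T) = k.
  by rewrite mxrankMfree// row_free_unit unitmx_tr.
have sJ : (P *m J^T <= kermx (G *m P))%MS.
  by apply/sub_kermxP; rewrite -oJ !mulmxA.
have sK : (P *m K^T <= kermx (G *m P))%MS.
  by apply/sub_kermxP; rewrite -oK !mulmxA.
(* The inclusion is an equality by dimension: the left rank is k, the right one n - k, and n =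
   2k. *)
have eJ : (P *m J^T == kermx (G *m P))%MS.
  rewrite -(mxrank_leqif_eq sJ) rJ mxrank_ker rGP -k2 -addnn.
  by rewrite addnK eqxx.
have /submxP [D HD] : (P *m K^T <= P *m J^T)%MS.
  by apply: submx_trans sK _; rewrite (eqmxP eJ).
have KP : K *m P = J *m P *m D^T.
  apply: trmx_inj; rewrite !trmx_mul PT trmxK HD.
  by [].
have JK : J *m K = I.
  have : I *m (I *m (J *m K)) = I *m (K *m K) by rewrite (mulmxA I J) IJ.
  by rewrite mulmxA II KK mulNmx mul1mx mulmxN mulmx1 => /oppr_inj.
have IP : I *m P = - (P *m D^T).
  by rewrite -JK -mulmxA KP !mulmxA JJ mulNmx mul1mx mulNmx.
by rewrite IP mulmxN mulmxA pid_mx_idem.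
Qed.

(** * Complex bases of invariant subspaces *)

Section ComplexBasis.
Context (n : nat) (J : 'M[R]_n) (JJ : J *m J = - 1%:M).

Let JJv (v : 'cV[R]_n) : J *m (J *m v) = - v.
Proof. by rewrite mulmxA JJ mulNmx mul1mx. Qed.

(** The real basis underlying a complex one, interleaved in the order Re z_0, Im z_0, Re z_1, ... of
    [standard_complex]. *)
Definition conj_pairs (s : seq 'cV[R]_n) : seq 'cV[R]_n :=
  flatten [seq [:: v; J *m v] | v <- s].

Lemma size_conj_pairs s : size (conj_pairs s) = (size s).*2.
Proof. by elim: s => //= v s ->. Qed.

Lemma conj_pairs_cat s1 s2 :
  conj_pairs (s1 ++ s2) = conj_pairs s1 ++ conj_pairs s2.
Proof. by rewrite /conj_pairs map_cat flatten_cat. Qed.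

Lemma nth_conj_pairs s i :
  (conj_pairs s)`_i.*2 = s`_i /\ (conj_pairs s)`_i.*2.+1 = J *m s`_i.
Proof.
by elim: s i => [|v s IH] [|i] //=; rewrite ?nth_nil mulmx0.
Qed.

Lemma span_conj_pairs_stable s v :
  v \in <<conj_pairs s>>%VS -> J *m v \in <<conj_pairs s>>%VS.
Proof.
have lin : linear (mulmx J : 'cV[R]_n -> 'cV[R]_n).
  by move=> a x y; rewrite linearP.
suff : (<<conj_pairs s>> <=
    linfun (mulmx J : 'cV[R]_n -> 'cV[R]_n) @^-1: <<conj_pairs s>>)%VS.
  by move=> /subvP H /H; rewrite -memv_preim lfunE.
apply/span_subvP => w; rewrite -memv_preim lfunE /=.
move=> /flattenP [_ /mapP [u us ->]]; rewrite !inE => /orP[] /eqP ->.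
  apply/memv_span/flattenP; exists [:: u; J *m u]; first exact: map_f.
  by rewrite !inE eqxx orbT.
rewrite JJv rpredN; apply/memv_span/flattenP.
by exists [:: u; J *m u]; [exact: map_f|rewrite !inE eqxx].
Qed.

(* If J v = a v + u with u in the span U, applying J gives
   - (1 + a^2) v = a u + J u in U. *)
Lemma free_conj_pairs_rcons s v : free (conj_pairs s) ->
  v \notin <<conj_pairs s>>%VS -> free (conj_pairs (rcons s v)).
Proof.
move=> fs vs; rewrite -cats1 conj_pairs_cat.
rewrite (@perm_free _ _ _ (J *m v :: v :: conj_pairs s)); last first.
  by rewrite perm_catC /= (perm_catCA [:: v] [:: J *m v]).
rewrite !free_cons vs fs !andbT; apply: contra vs.
rewrite span_cons => /memv_addP [_ /vlineP [a ->] [u us Jv]].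
have : (- (1 + a ^+ 2)) *: v = a *: u + J *m u.
  have := congr1 (mulmx J) Jv; rewrite JJv mulmxDr -scalemxAr Jv.
  move: (J *m u) => Ju /matrixP H; apply/matrixP => i j.
  by have := H i j; rewrite !mxE; lra.
move=> E; rewrite -[v]scale1r -(@mulVf _ (- (1 + a ^+ 2))); last first.
  by rewrite oppr_eq0 gt_eqF// ltr_pwDl// sqr_ge0.
by rewrite -scalerA E rpredZ// rpredD ?rpredZ// span_conj_pairs_stable.
Qed.

(** Any vector of [W] outside the current span can be added together with its image under [J], so
    the induction is on the number of missing dimensions. *)
Lemma conj_pairs_complete (W : {vspace 'cV[R]_n}) s :
  (forall v, v \in W -> J *m v \in W) ->
  free (conj_pairs s) -> (<<conj_pairs s>> <= W)%VS ->
  exists s', free (conj_pairs (s ++ s')) /\ <<conj_pairs (s ++ s')>>%VS = W.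
Proof.
move=> JW; have [m] := ubnP (\dim W - size (conj_pairs s)).
elim: m s => // m IH s Hm fs sW.
have [WS|/subvPn [v vW vs]] := boolP (W <= <<conj_pairs s>>)%VS.
  by exists [::]; rewrite cats0; split=> //; apply/eqP; rewrite eqEsubv sW.
have fs' := free_conj_pairs_rcons fs vs.
have sW' : (<<conj_pairs (rcons s v)>> <= W)%VS.
  rewrite -cats1 conj_pairs_cat span_cat subv_add sW /=.
  by rewrite span_cons span_seq1 subv_add -!memvE vW JW.
have [|s' [f' S']] := IH _ _ fs' sW'; last first.
  by exists (v :: s'); rewrite -cat_rcons.
have := dimvS sW'; have := dimvS sW; move: (fs) (fs') => /eqP -> /eqP ->.
rewrite !size_conj_pairs size_rcons in Hm *. move=> _; move: (\dim W) Hm => d; lia.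
Qed.

End ComplexBasis.

(** * The standard complex structure and coordinate projections *)

Lemma standard_complex_odd n (i j : 'I_n) : odd j ->
  standard_complex R n i j = - (i.+1 == j)%:R.
Proof. by move=> oj; rewrite mxE oj; case: ifP => _; rewrite ?oppr0. Qed.

Lemma standard_complex_even n (i j : 'I_n) : ~~ odd j ->
  standard_complex R n i j = (i == j.+1 :> nat)%:R.
Proof. by move=> /negPf oj; rewrite mxE oj; case: ifP. Qed.

Lemma pid_mxE n k (i j : 'I_n) :
  (pid_mx k : 'M[R]_n) i j = ((i == j) && (i < k)%N)%:R.
Proof. by rewrite mxE. Qed.

Lemma pid_mx_mull n m k (A : 'M[R]_(n, m)) i j :
  ((pid_mx k : 'M[R]_n) *m A) i j = if (i < k)%N then A i j else 0.
Proof.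
rewrite mxE (bigD1 i)//= big1 ?addr0 => [|l li].
  by rewrite pid_mxE eqxx; case: ifP; rewrite ?mul1r ?mul0r.
by rewrite pid_mxE eq_sym (negPf li) mul0r.
Qed.

Lemma pid_mx_mulr n m k (A : 'M[R]_(m, n)) i j :
  (A *m (pid_mx k : 'M[R]_n)) i j = if (j < k)%N then A i j else 0.
Proof.
rewrite mxE (bigD1 j)//= big1 ?addr0 => [|l lj].
  by rewrite pid_mxE eqxx; case: ifP; rewrite ?mulr1 ?mulr0.
by rewrite pid_mxE (negPf lj) mulr0.
Qed.

Lemma sliceP n k (u : 'cV[R]_n) :
  (pid_mx k : 'M[R]_n) *m u = u <-> forall i : 'I_n, (k <= i)%N -> u i 0 = 0.
Proof.
split=> [Pu i ki|H].
  by rewrite -Pu pid_mx_mull ltnNge ki.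
apply/matrixP => i j; rewrite pid_mx_mull ord1; case: ltnP => // /H -> //.
Qed.

(** An even cut-off never separates the two real coordinates of one complex coordinate. *)
Lemma standard_complex_pid n d :
  (pid_mx d.*2 : 'M[R]_n) *m standard_complex R n =
  standard_complex R n *m (pid_mx d.*2 : 'M[R]_n).
Proof.
apply/matrixP => i j; rewrite pid_mx_mull pid_mx_mulr.
have [oj|oj] := boolP (odd j).
  rewrite standard_complex_odd//; case: eqP => [E|_]; last first.
    by rewrite oppr0; do 2 case: ifP.
  have -> // : (i < d.*2)%N = (j < d.*2)%N.
  by move: oj; rewrite -E /= => oi; apply/idP/idP; lia.
rewrite standard_complex_even//; case: eqP => [E|_]; last by do 2 case: ifP.
have -> // : (i < d.*2)%N = (j < d.*2)%N.
by rewrite E; apply/idP/idP; lia.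
Qed.

(** The hypothesis on [D] says that its image is [J]-stable. The columns of [Q] are a complex basis
    of this image followed by a completion to the whole space, so [invmx Q] is a complex linear
    change of coordinates carrying the image onto the first [d.*2] coordinates. *)
Lemma complex_basis n (J D D' : 'M[R]_n) :
  J *m J = - 1%:M -> J *m D = D *m D' ->
  exists (Q : 'M[R]_n) d, [/\ Q \in unitmx, J *m Q = Q *m standard_complex R n,
    \rank D = d.*2 &
    (pid_mx d.*2 : 'M[R]_n) *m (invmx Q *m D) = invmx Q *m D].
Proof.
move=> JJ JD; set P := fun d => pid_mx d : 'M[R]_n.
have lin (A : 'M[R]_n) : linear (mulmx A : 'cV[R]_n -> 'cV[R]_n).
  by move=> a x y; rewrite linearP.
pose T := limg (linfun (mulmx D : 'cV[R]_n -> 'cV[R]_n)).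
have TP t : reflect (exists u, t = D *m u) (t \in T).
  apply: (iffP memv_imgP) => [[u _ ->]|[u ->]].
    by exists u; rewrite lfunE.
  by exists u; rewrite ?memvf// lfunE.
have JT t : t \in T -> J *m t \in T.
  move=> /TP [u ->]; apply/TP; exists (D' *m u).
  by rewrite mulmxA JD mulmxA.
have [||s1 /= [f1 S1]] := conj_pairs_complete JJ JT (s := [::]).
- by rewrite /conj_pairs /= nil_free.
- by rewrite /conj_pairs /= span_nil sub0v.
have [||s2 [f2 S2]] := @conj_pairs_complete n J JJ fullv s1 _ f1.
- by move=> v _; rewrite memvf.
- exact: subvf.
set X := conj_pairs J (s1 ++ s2) in f2 S2.
have sX : size X = n.
  by move/eqP: f2; rewrite S2 dimvf => <-; rewrite /dim /= muln1.
have n2 : (size (s1 ++ s2)).*2 = n by rewrite -(size_conj_pairs J).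
pose d := size s1.
have dn : (d.*2 <= n)%N by rewrite -n2 size_cat doubleD leq_addr.
have X1 i : (i < d.*2)%N -> X`_i = (conj_pairs J s1)`_i.
  by move=> id2; rewrite /X conj_pairs_cat nth_cat size_conj_pairs id2.
pose Q : 'M[R]_n := \matrix_(i, j) X`_j i 0.
have QE (u : 'cV[R]_n) : Q *m u = \sum_j u j 0 *: X`_j.
  apply/matrixP => i j; rewrite summxE mxE; apply: eq_bigr => l _.
  by rewrite ord1 !mxE mulrC.
have Qd (j : 'I_n) : Q *m delta_mx j 0 = X`_j.
  by rewrite -colE; apply/matrixP => i l; rewrite ord1 !mxE.
have uQ : Q \in unitmx.
  apply: unitmx_inj => u; rewrite QE => H.
  have /freeP F : free (Tuple (introT eqP sX)) by [].
  by apply/matrixP => i j; rewrite ord1 mxE; exact: (F (fun j => u j 0)).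
have PQ t : t \in T -> P d.*2 *m (invmx Q *m t) = invmx Q *m t.
  have -> : T = <<in_tuple (conj_pairs J s1)>>%VS by rewrite -S1.
  move=> /coord_span ->; rewrite !mulmx_sumr; apply: eq_bigr => i _.
  rewrite -!scalemxAr; congr (_ *: _).
  have id2 : (i < d.*2)%N by rewrite -(size_conj_pairs J) ltn_ord.
  have iN : (i < n)%N by exact: leq_trans id2 dn.
  rewrite /= -X1// -(Qd (Ordinal iN)) mulKmx//.
  apply/matrixP => a b; rewrite pid_mx_mull !mxE; case: ifP => //.
  by case: eqP => // -> /=; rewrite id2.
have PQD : P d.*2 *m (invmx Q *m D) = invmx Q *m D.
  apply/matrixP => i j.
  suff /matrixP/(_ i 0) : col j (P d.*2 *m (invmx Q *m D)) = col j (invmx Q *m D).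
    by rewrite [LHS]mxE [X in _ = X]mxE.
  rewrite !colE -[RHS]mulmxA -PQ; last by apply/TP; exists (delta_mx j 0).
  by rewrite !mulmxA.
have rD : \rank D = d.*2.
  apply/eqP; rewrite eqn_leq; apply/andP; split.
    rewrite -(eqmxMfull D (_ : row_full (invmx Q))); last first.
      by rewrite row_full_unit unitmx_inv.
    by rewrite -PQD (leq_trans (mxrankM_maxl _ _))// rank_pid_mx.
  (* For the other inequality, the first [d.*2] columns of [Q] lie in the image of [D]; transposing
     makes this an inclusion of row spaces. *)
  have <- : \rank (Q *m P d.*2) = d.*2.
    by rewrite (eqmxMfull _ (_ : row_full Q)) ?row_full_unit// rank_pid_mx.
  rewrite -mxrank_tr -[X in (_ <= X)%N]mxrank_tr; apply: mxrankS.
  apply/row_subP => i; rewrite -tr_col.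
  have [id2|id2] := boolP (i < d.*2)%N; last first.
    suff -> : col i (Q *m P d.*2) = 0 by rewrite trmx0 sub0mx.
    apply/matrixP => a b; rewrite [RHS]mxE mxE.
    by have := pid_mx_mulr d.*2 Q a i; rewrite (negPf id2) => ->.
  have -> : col i (Q *m P d.*2) = X`_i.
    apply/matrixP => a b; rewrite ord1 mxE.
    by have := pid_mx_mulr d.*2 Q a i; rewrite id2 => ->; rewrite mxE.
  have /TP [u ->] : X`_i \in T.
    by rewrite -S1 X1//; apply/memv_span/mem_nth; rewrite size_conj_pairs.
  by rewrite trmx_mul submxMl.
exists Q, d; split=> //.
- apply/matrixP => i j.
  have -> : (J *m Q) i j = (J *m X`_j) i 0.
    by rewrite !mxE; apply: eq_bigr => l _; rewrite mxE.
  (* Column [j] of [standard_complex] has one nonzero entry. For odd [j] it is -1 in row [j - 1], as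
     [J] sends [J v] to [- v]; for even [j] it is 1 in row [j + 1], which exists because [n] is
     even. *)
  have [oj|oj] := boolP (odd j).
    have jE : j = j./2.*2.+1 :> nat by rewrite -{1}(odd_double_half j) oj.
    have ltj : (j./2.*2 < n)%N by rewrite (ltn_trans _ (ltn_ord j))// {2}jE.
    rewrite [RHS]mxE (bigD1 (Ordinal ltj))//= standard_complex_odd//=.
    rewrite -jE eqxx big1 => [|l ll]; last first.
      rewrite standard_complex_odd//; case: eqP => [E|]; last first.
        by rewrite oppr0 mulr0.
      by case/eqP: ll; apply: val_inj => /=; apply: succn_inj; rewrite E -jE.
    have -> : X`_j = J *m X`_(j./2.*2).
      by rewrite {1}jE /X; have [-> ->] := nth_conj_pairs J (s1 ++ s2) j./2.
    by rewrite mulmxA JJ mulNmx mul1mx [LHS]mxE [Q i _]mxE /= addr0 mulrN1.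
  have jE : j = j./2.*2 :> nat by rewrite -{1}(odd_double_half j) (negPf oj).
  have ltj : (j.+1 < n)%N by have := ltn_ord j; move: oj n2; lia.
  rewrite [RHS]mxE (bigD1 (Ordinal ltj))//= standard_complex_even//=.
  rewrite eqxx big1 => [|l ll]; last first.
    rewrite standard_complex_even//; case: eqP => [E|]; last by rewrite mulr0.
    by case/eqP: ll; exact: val_inj.
  have -> : J *m X`_j = X`_j.+1.
    by rewrite {1}jE {2}jE /X; have [-> ->] := nth_conj_pairs J (s1 ++ s2) j./2.
  by rewrite [Q i _]mxE /= addr0 mulr1.
Qed.

End LinearAlgebra.

(** * Holomorphic charts adapted to a submanifold *)

Section ChartLemmas.
Context (R : realType) (n : nat) (M : topologicalType).
Implicit Types c : chart R n M.

Lemma ptK c u : codom c u -> dom c (pt c u) /\ coord c (pt c u) = u.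
Proof. by move=> [x dx <-]; rewrite coordK. Qed.

Lemma codom_coord c x : dom c x -> codom c (coord c x).
Proof. by move=> dx; exists x. Qed.

Lemma image_coordE c (A : set M) :
  coord c @` (dom c `&` A) = codom c `&` pt c @^-1` A.
Proof.
apply/seteqP; split=> [_ [x [dx Ax] <-]|u [cu Au]].
  by split; [exact: codom_coord|rewrite /preimage /= coordK].
by have [dp pE] := ptK cu; exists (pt c u).
Qed.

Lemma open_image_coord c (A : set M) : open A -> open (coord c @` (dom c `&` A)).
Proof.
move=> oA; rewrite image_coordE.
apply: open_setI_preimage => //; first exact: coord_open.
exact: pt_continuous.
Qed.

End ChartLemmas.

Section ManifoldLemmas.
Context (R : realType) (n : nat) (M : manifold R n).
Implicit Types c : chart R n M.

Lemma smooth_transition c c' : atlas c -> atlas c' ->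
  smooth (coord c @` (dom c `&` dom c')) (transition c c').
Proof. by move=> ac ac'; have [] := atlas_compatible ac ac'. Qed.

(** Source of new charts: by maximality of the atlas only compatibility has to be checked, and every
    transition to or from [c'] factors through one of [c]. *)
Lemma chart_comp c (O : set 'cV[R]_n) (th th' : 'cV[R]_n -> 'cV[R]_n) :
  atlas c -> open O -> O `<=` codom c -> smooth O th ->
  open (th @` O) -> smooth (th @` O) th' -> (forall u, O u -> th' (th u) = u) ->
  exists c' : chart R n M, [/\ atlas c',
    (forall x, dom c' x <-> dom c x /\ O (coord c x)) &
    (forall x, coord c' x = th (coord c x))].
Proof.
move=> ac oO Oc sth oO' sth' thK.
pose D := dom c `&` coord c @^-1` O.
have oD : open D.
  exact: open_setI_preimage (@dom_open _ _ _ c) oO (@coord_continuous _ _ _ c).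
have imD : (th \o coord c) @` D = th @` O.
  apply/seteqP; split=> [_ [x [dx Ox] <-]|_ [u Ou <-]].
    by exists (coord c x).
  have [dp pE] := ptK (Oc _ Ou).
  by exists (pt c u); [split=> //; rewrite /preimage /= pE|rewrite /= pE].
have H1 : open ((th \o coord c) @` D) by rewrite imD.
have H2 x : D x -> (pt c \o th') ((th \o coord c) x) = x.
  by move=> [dx Ox] /=; rewrite thK// coordK.
have H3 x : D x -> {for x, continuous (th \o coord c)}.
  move=> [dx Ox]; apply: continuous_comp; first exact: coord_continuous.
  exact: smooth_continuous sth Ox.
have H4 u : ((th \o coord c) @` D) u -> {for u, continuous (pt c \o th')}.
  rewrite imD => Ou; apply: continuous_comp; first exact: smooth_continuous sth' Ou.
  by move: Ou => [v Ov <-]; rewrite thK//; exact/pt_continuous/Oc.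
pose c' := Chart oD H1 H2 H3 H4.
exists c'; split=> //; apply: atlas_maximal => c'' ac''.
have oi : open (coord c' @` (dom c' `&` dom c'')).
  exact/open_image_coord/dom_open.
have oi' : open (coord c'' @` (dom c' `&` dom c'')).
  by rewrite setIC; exact/open_image_coord/dom_open.
split=> k.
  apply: (@Ck_comp R _ n n 1 k _ (coord c @` (dom c `&` dom c'')) th'
    (transition c c'')) => //.
  - exact/open_image_coord/dom_open.
  - move=> _ [x [[dx Ox] dx'] <-]; exists x => //.
    by rewrite /= thK.
  - by apply: sub_Ck (sth' k) => _ [x [[dx Ox] dx'] <-]; exists (coord c x).
  - exact: smooth_transition.
apply: (@Ck_comp R _ n n 1 k _ O (transition c'' c) th) => //.
  by move=> _ [x [[dx Ox] dx'] <-]; rewrite /transition coordK.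
apply: sub_Ck (smooth_transition ac'' ac k) => _ [x [[dx Ox] dx'] <-].
by exists x.
Qed.

End ManifoldLemmas.

Section AdaptedHolomorphic.
Context (R : realType).

(* [F] is the differential of the graph map of [adapted_holomorphic_chart]: [B]
   is the complex linear coordinate change, [Z] the differential of the
   parametrization of N, [H] that of the local inverse of P B Z P + (1 - P), and
   [A] the complex structure of the slice read in the parametrization. *)
Lemma graph_complex n (P B Z H A J : 'M[R]_n) :
  P *m P = P -> J *m P = P *m J -> B *m J = J *m B ->
  J *m (Z *m P) = Z *m (P *m A) -> P *m A = A ->
  (P *m (B *m (Z *m P)) + (1%:M - P)) *m H = 1%:M ->
  let F := (1%:M - P) *m (B *m (Z *m (P *m (H *m P)))) in
  F *m J = J *m F.
Proof.
move=> PP JP BJ JZ PA XH; set X := _ + _ in XH.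
have HX : H *m X = 1%:M by apply: mulmx1C.
have nPP : (1%:M - P) *m P = 0 by rewrite mulmxBl mul1mx PP subrr.
(* [X] is the identity modulo the image of [P], so its inverse [H] preserves that image. *)
have nPX : (1%:M - P) *m X = 1%:M - P.
  by rewrite /X mulmxDr mulmxA nPP mul0mx add0r mulmxBr mulmx1 nPP subr0.
have nPH : (1%:M - P) *m (H *m P) = 0.
  by rewrite -nPX -mulmxA (mulmxA X) XH mul1mx mulmxBl mul1mx PP subrr.
have PHP : P *m (H *m P) = H *m P.
  by move: nPH; rewrite mulmxBl mul1mx => /eqP; rewrite subr_eq0 eq_sym => /eqP.
have XHP : X *m (H *m P) = P by rewrite mulmxA XH mul1mx.
have ZHP : P *m (B *m (Z *m (P *m (H *m P)))) = P.
  by move: XHP; rewrite /X mulmxDl nPH addr0 -!mulmxA.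
(* On the slice, [P *m B *m Z] carries [A] to [J], so its inverse [H] carries [J] back to [A]. *)
have key : A *m (H *m P) = H *m (P *m J).
  have XA : X *m (A *m (H *m P)) = P *m J.
    rewrite /X mulmxDl mulmxBl mul1mx (mulmxA P A) PA subrr addr0.
    rewrite -!mulmxA (mulmxA P A) PA.
    have -> : Z *m (A *m (H *m P)) = J *m (Z *m (P *m (H *m P))).
      by rewrite -[in LHS]PA -!mulmxA (mulmxA Z) (mulmxA (Z *m P)) -(mulmxA Z)
        -JZ -!mulmxA.
    by rewrite (mulmxA B) BJ -(mulmxA J) (mulmxA P) -JP -(mulmxA J) ZHP JP.
  by rewrite -XA (mulmxA H X) HX mul1mx.
rewrite /= -!mulmxA -key.
have -> : Z *m (P *m (A *m (H *m P))) = J *m (Z *m (P *m (H *m P))).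
  by rewrite (mulmxA P A) (mulmxA Z) -JZ -!mulmxA.
rewrite (mulmxA B) BJ -(mulmxA J) [LHS]mulmxA [RHS]mulmxA.
by congr (_ *m _); rewrite mulmxBl mul1mx mulmxBr mulmx1 JP.
Qed.

Context (n : nat) (M : manifold R n) (N : set M) (k : nat) (A : components M).
Context (kn : (k <= n)%N) (fA : endomorphism_field A).
Context (AA : forall x c, chart_at x c -> A c x *m A c x = - 1%:M).
Context (x : M) (c0 c1 : chart R n M).
Context (Nx : N x) (hc0 : holomorphic_chart A c0) (c0x : dom c0 x).
Context (ac1 : atlas c1) (c1x : dom c1 x) (adc1 : adapted_chart N k c1).
Let P : 'M[R]_n := pid_mx k.
Context (PA : forall y, N y -> dom c1 y ->
  P *m (A c1 y *m P) = A c1 y *m P).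

(** [PA] expresses that the tangent spaces of N are stable under [A]. In the proof [tau] restricted
    to the image of [P] parametrizes N in the holomorphic chart [c0], [B] straightens the tangent
    space at [x], N becomes the graph of [F] over the first k coordinates, and the shear [th]
    flattens it. *)
Lemma adapted_holomorphic_chart : exists d c,
  [/\ k = d.*2, holomorphic_chart A c, dom c x & adapted_chart N k c].
Proof.
have [ac0 A0] := hc0.
pose J0 : 'M[R]_n := standard_complex R n.
pose tau := transition c1 c0.
pose W0 := coord c1 @` (dom c1 `&` dom c0).
have oW0 : open W0 by exact/open_image_coord/dom_open.
have stau : smooth W0 tau by exact: smooth_transition.
have W0P s : W0 s -> [/\ dom c1 (pt c1 s), dom c0 (pt c1 s),
    coord c1 (pt c1 s) = s & tau s = coord c0 (pt c1 s)].
  by move=> [y [d1 d0] <-]; rewrite /tau /transition coordK.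
have dtau s : W0 s -> differentiable tau s.
  by move=> /(smooth_differentiable stau).
pose Z s := jac tau s.
have NP y : dom c1 y -> N y <-> P *m coord c1 y = coord c1 y.
  by move=> dy; apply: iff_trans (adc1 dy) _; apply: iff_sym; exact: sliceP.
have PP : P *m P = P by exact: pid_mx_idem.
(* Naturality of the endomorphism field under [tau], evaluated on the vectors of the slice: in [c0]
   the field is [J0], and [PA] keeps its values in [c1] inside the slice. *)
have JZ s : W0 s -> P *m s = s ->
    J0 *m (Z s *m P) = Z s *m (P *m (A c1 (pt c1 s) *m P)).
  move=> Ws Ps; have [d1 d0 ptE tE] := W0P _ Ws.
  set y := pt c1 s in d1 d0 ptE tE *.
  have Ny : N y by apply/NP => //; rewrite ptE.
  have [_ fAy] := fA.
  have c1y : chart_at y c1 by [].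
  have c0y : chart_at y c0 by [].
  rewrite (PA Ny d1); apply/matrixP => i j.
  have := fAy y c1 c0 c1y c0y (P *m delta_mx j 0).
  rewrite /dtransition ptE -/tau !(jacE _ (dtau s Ws)).
  rewrite (A0 y d0) -/J0 -/(Z s) !mulmxA -colE -colE => /matrixP/(_ i 0).
  by rewrite !mxE => ->.
have uZ s : W0 s -> Z s \in unitmx.
  move=> Ws; pose tau' := transition c0 c1.
  have [d1 d0 ptE tE] := W0P _ Ws.
  suff H : jac tau' (tau s) *m Z s = 1%:M by have [] := mulmx1_unit H.
  apply: jac_left_inverse oW0 Ws _ (dtau s Ws) _.
    move=> u /W0P[d1' d0' uE ->]; by rewrite /tau' /transition coordK.
  apply: (smooth_differentiable (smooth_transition ac0 ac1)).
  by rewrite tE; exists (pt c1 s).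
pose s0 := coord c1 x.
have Ws0 : W0 s0 by exists x.
have Ps0 : P *m s0 = s0 by apply/NP.
have [||Q [d [uQ JQ rD PD]]] := @complex_basis R n J0 (Z s0 *m P) (A c1 x *m P).
- by rewrite /J0 -(A0 _ c0x); apply: AA.
- by rewrite JZ// /s0 coordK// -mulmxA.
(* The evenness of k comes from here: the tangent space at [x] has real dimension k and carries a
   complex basis. *)
have kd : k = d.*2.
  rewrite -rD (eqmxMfull _ (_ : row_full (Z s0))); first by rewrite rank_pid_mx.
  by rewrite row_full_unit uZ.
rewrite -kd -/P in PD; exists d.
pose B := invmx Q.
have BQ : B *m Q = 1%:M by rewrite mulVmx.
have QB : Q *m B = 1%:M by rewrite mulmxV.
have BJ : B *m J0 = J0 *m B.
  by rewrite -[LHS]mulmx1 -QB -!mulmxA (mulmxA J0) JQ -/J0 !mulmxA BQ mul1mx.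
have JP : J0 *m P = P *m J0 by rewrite /P kd -standard_complex_pid.
pose nP : 'M[R]_n := 1%:M - P.
have nPP : nP *m P = 0 by rewrite mulmxBl mul1mx PP subrr.
have PnP : P *m nP = 0 by rewrite mulmxBr mulmx1 PP subrr.
(* [Phi] extends the projection of N to the first k coordinates by the identity
   on the complementary ones, so that it is a local diffeomorphism of R^n. *)
pose Phi u := P *m (B *m tau (P *m u)) + nP *m u.
pose U := mulmx P @^-1` W0.
have oU : open U by apply: open_comp => // ? _; exact: mulmx_continuous.
have sPhi : smooth U Phi.
  move=> l; apply: CkD => //; last exact/Ck_mulmxl/Ck_id.
  do 2 apply: Ck_mulmxl => //.
  apply: (@Ck_comp R _ n n 1 l U W0 (mulmx P) tau) => //.
  exact/Ck_mulmxl/Ck_id.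
have jPhi u : U u -> jac Phi u = P *m (B *m (Z (P *m u) *m P)) + nP.
  move=> Uu; have dt := dtau _ Uu.
  have dP := differentiable_mulmx P u.
  have dtP : differentiable (fun u => tau (P *m u)) u by exact: differentiable_comp.
  have dB := differentiable_mulmxl B dtP.
  rewrite jacD; last exact: differentiable_mulmx; last exact: differentiable_mulmxl.
  rewrite (jac_mulmxl P dB) (jac_mulmxl B dtP) (jac_comp dP dt).
  by rewrite !jac_mulmx.
have Us0 : U s0 by rewrite /U /preimage /= Ps0.
(* By [PD] the image of [B *m (Z s0 *m P)] lies in that of [P], so applying [P] to a kernel relation
   separates its two summands. *)
have uPhi : jac Phi s0 \in unitmx.
  rewrite jPhi// Ps0; apply: unitmx_inj => v; rewrite mulmxDl => H.
  have H1 : B *m (Z s0 *m P) *m v = 0.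
    have := congr1 (mulmx P) H.
    by rewrite mulmxDr mulmx0 !(mulmxA P) PP PnP mul0mx addr0 PD.
  rewrite PD H1 add0r in H.
  have Pv : P *m v = 0.
    have := congr1 (mulmx (invmx (Z s0) *m Q)) H1.
    by rewrite mulmx0 -!mulmxA (mulmxA Q) QB mul1mx mulKmx// uZ.
  by move: H; rewrite /nP mulmxBl mul1mx Pv subr0.
have [W [V [h [oW oV Ws0' WU [hPhi Phih sh]]]]] :=
  inverse_function oU sPhi Us0 uPhi.
(* [s p] is the [c1]-coordinate of the point of N lying over [P *m p]. It stays in the slice because
   [Phi] does not change the complementary coordinates. [F] reads off the complementary part of that
   point. *)
pose s p := h (P *m p).
pose F p := nP *m (B *m tau (P *m s p)).
pose E := mulmx P @^-1` V.
have oE : open E by apply: open_comp => // ? _; exact: mulmx_continuous.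
have sP p : E p -> P *m s p = s p.
  move=> /Phih [_ H]; have := congr1 (mulmx nP) H.
  rewrite /Phi -/(s p) mulmxDr !(mulmxA nP) nPP !mul0mx add0r.
  have -> : nP *m nP = nP by rewrite {2}/nP mulmxBr mulmx1 nPP subr0.
  by rewrite /nP mulmxBl mul1mx => /eqP; rewrite subr_eq0 => /eqP.
have EW p : E p -> W (s p) by move=> /Phih [].
have EW0 p : E p -> W0 (s p).
  by move=> Ep; have := WU _ (EW _ Ep); rewrite /U /preimage /= sP.
have PBs p : E p -> P *m (B *m tau (s p)) = P *m p.
  move=> Ep; have [_] := Phih _ Ep; rewrite /Phi -/(s p) sP// => H.
  have := congr1 (mulmx P) H; rewrite mulmxDr !(mulmxA P) PP PnP mul0mx addr0.
  by rewrite -mulmxA.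
have PF p : P *m F p = 0 by rewrite /F mulmxA PnP mul0mx.
have FP p q : P *m p = P *m q -> F p = F q by move=> pq; rewrite /F /s pq.
have sF : smooth E F.
  move=> l; do 2 apply: Ck_mulmxl => //.
  apply: (@Ck_comp R _ n n 1 l E W0 (fun p => P *m s p) tau) => //.
    by move=> p Ep; rewrite sP//; exact: EW0.
  apply: Ck_mulmxl => //.
  apply: (@Ck_comp R _ n n 1 l E V (mulmx P) h) => //.
  exact/Ck_mulmxl/Ck_id.
(* [F] depends only on the [P]-part of its argument and has values with zero [P]-part, so [th] and
   [th'] are mutually inverse on all of R^n. *)
pose th u := B *m u - F (B *m u).
pose th' q := Q *m (q + F q).
have Eth u : P *m (B *m u - F (B *m u)) = P *m (B *m u).
  by rewrite mulmxBr PF subr0.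
have Eth' q : P *m (q + F q) = P *m q by rewrite mulmxDr PF addr0.
(* The condition on [W] makes [h] invert [Phi] at the [c1]-coordinate of each point, which
   identifies the points of N with the graph; the condition on [E] makes [F] smooth. *)
pose O1 := coord c0 @` (dom c0 `&` (dom c1 `&` coord c1 @^-1` W)).
have oO1 : open O1.
  apply: open_image_coord.
  exact: open_setI_preimage (@dom_open _ _ _ c1) oW (@coord_continuous _ _ _ c1).
pose O := O1 `&` (mulmx B @^-1` E).
have oO : open O.
  apply: openI => //; apply: open_comp => // ? _; exact: mulmx_continuous.
have thK u : th' (th u) = u.
  by rewrite /th' /th (FP _ _ (Eth u)) subrK mulmxA QB mul1mx.
have th'K q : th (th' q) = q.
  by rewrite /th' /th mulmxA BQ mul1mx (FP _ _ (Eth' q)) addrK.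
have Oc : O `<=` codom c0 by move=> _ [[y [d0 _] <-] _]; exists y.
have sBF l (X : set 'cV[R]_n) : open X -> X `<=` mulmx B @^-1` E ->
    Ck l X (fun u => F (B *m u)).
  move=> oX XE; apply: (@Ck_comp R _ n n 1 l X E (mulmx B) F) => //.
  exact/Ck_mulmxl/Ck_id.
have OE : O `<=` mulmx B @^-1` E by move=> u [].
have sth : smooth O th.
  move=> l; have H := CkD oO (Ck_mulmxl B oO (Ck_id l O))
    (Ck_mulmxl (- 1%:M) oO (sBF l O oO OE)).
  by apply: near_eq_Ck H => // u _; rewrite mulNmx mul1mx.
have sth' : smooth E th'.
  move=> l; apply: Ck_mulmxl => //; apply: CkD => //; exact: Ck_id.
have imO : th @` O = E `&` th' @^-1` O.
  apply/seteqP; split=> [_ [u [Hu Eu] <-]|q [Eq Oq]]; last first.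
    by exists (th' q) => //; rewrite th'K.
  split; last by rewrite /preimage /= thK.
  by rewrite /E /preimage /= /th Eth.
have oO' : open (th @` O).
  rewrite imO; apply: (open_setI_preimage oE oO) => q Eq.
  exact: smooth_continuous sth' Eq.
have [||c [ac dc cc]] := chart_comp ac0 oO Oc sth oO' (th' := th').
- by move=> l; apply: sub_Ck (sth' l); rewrite imO => q [].
- by move=> u _; exact: thK.
have dcP y : dom c y -> [/\ dom c0 y, dom c1 y, W (coord c1 y) &
    E (B *m coord c0 y)].
  move=> /dc [d0 [[z [d0' [d1 Wz]] zE] Ey]].
  have zy : z = y by rewrite -(coordK d0') zE coordK.
  by subst z.
exists c; split=> //.
- split=> // y dy; have [d0 d1 Wy Ey] := dcP y dy.
  set u0 := coord c0 y in Ey; set p := B *m u0 in Ey.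
  have Ou0 : O u0 by have [] := (dc y).1 dy.
  have Wsp := EW0 _ Ey.
  have [d1' d0' ptE tE] := W0P _ Wsp.
  (* The point [y] need not lie on N. The differential of [F] at [p] is governed by the point [z] of
     N over [P *m p], and tangent stability is applied there. *)
  set z := pt c1 (s p) in d1' d0' ptE tE.
  have Nz : N z by apply/NP => //; rewrite ptE sP.
  pose H := jac h (P *m p).
  have dP := differentiable_mulmx P p.
  have dh : differentiable h (P *m p) by exact: smooth_differentiable sh Ey.
  have dPhi : differentiable Phi (s p)
    by apply: smooth_differentiable sPhi _; exact/WU/EW.
  have XH : (P *m (B *m (Z (s p) *m P)) + nP) *m H = 1%:M.
    rewrite -{1}(sP _ Ey) -jPhi; last exact/WU/EW.
    by apply: (jac_left_inverse oV Ey) => // q /Phih[].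
  have ds : differentiable s p by exact: differentiable_comp.
  have dPs := differentiable_mulmxl P ds.
  have dtPs : differentiable (fun q => tau (P *m s q)) p.
    by apply: (differentiable_comp dPs); rewrite sP//; exact: dtau.
  have dBt := differentiable_mulmxl B dtPs.
  have dtsp : differentiable tau (P *m s p) by rewrite sP//; exact: dtau.
  have jF : jac F p = nP *m (B *m (Z (s p) *m (P *m (H *m P)))).
    rewrite (jac_mulmxl nP dBt) (jac_mulmxl B dtPs) (jac_comp dPs dtsp).
    by rewrite (jac_mulmxl P ds) (jac_comp dP dh) jac_mulmx sP.
  have FJ : jac F p *m J0 = J0 *m jac F p.
    have JZp := JZ _ Wsp (sP _ Ey).
    by rewrite jF; exact: (graph_complex PP JP BJ JZp (PA Nz d1') XH).
  have dF : differentiable F p by exact: smooth_differentiable sF Ey.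
  have dB0 := differentiable_mulmx B u0.
  have dFB : differentiable (fun u => F (B *m u)) u0 by exact: differentiable_comp.
  pose L := jac th u0.
  have LE : L = B - jac F p *m B.
    have -> : L = jac (fun u => B *m u + - 1%:M *m F (B *m u)) u0.
      by congr (jac _ u0); apply/funext => u; rewrite mulNmx mul1mx.
    rewrite jacD//; last exact: differentiable_mulmxl.
    by rewrite (jac_mulmxl _ dFB) (jac_comp dB0 dF) jac_mulmx mulNmx mul1mx.
  have LJ : L *m J0 = J0 *m L.
    by rewrite LE mulmxBl mulmxBr -mulmxA BJ !mulmxA FJ.
  have dth : differentiable th u0 by exact: smooth_differentiable sth Ou0.
  have dth' : differentiable th' (th u0).
    apply: smooth_differentiable sth' _.
    by rewrite /E /preimage /= /th Eth.
  have L'L : jac th' (th u0) *m L = 1%:M.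
    by apply: (jac_left_inverse oO Ou0) => // u _; exact: thK.
  have [_ uL] := mulmx1_unit L'L.
  have dtr v : dtransition c0 c y v = L *m v.
    rewrite /dtransition -jacE//; apply: near_eq_derive.
    apply: filterS (open_nbhs_nbhs (conj oO Ou0)) => u [[z' [dz' _] <-] _].
    by rewrite /transition coordK// cc.
  have [_ fAy] := fA.
  (* The transition to [c] carries [J0] to the components of [A] in [c]; as [L] is invertible and
     commutes with [J0], these components equal [J0]. *)
  have ALJ : A c y *m L = L *m J0.
    apply/matrixP => i j.
    have := fAy y c0 c (conj ac0 d0) (conj ac dy) (delta_mx j 0).
    rewrite !dtr (A0 y d0) !mulmxA -!colE => /matrixP/(_ i 0).
    by rewrite !mxE => ->.
  by rewrite -[LHS]mulmx1 -(mulmxV uL) mulmxA ALJ LJ mulmxK.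
- apply/dc; split=> //; split; first by exists x.
  rewrite /E /preimage /= -[coord c0 x](_ : tau s0 = _); last first.
    by rewrite /tau /transition /s0 coordK.
  have [] := hPhi _ Ws0'.
  rewrite /Phi Ps0; have -> : nP *m s0 = 0 by rewrite /nP mulmxBl mul1mx Ps0 subrr.
  by rewrite addr0.
- move=> y dy; have [d0 d1 Wy Ey] := dcP y dy.
  set p := B *m coord c0 y in Ey.
  (* Vanishing of the last coordinates in [c] is the graph equation, whose solutions remain to be
     matched with N. *)
  have Pc : (forall i : 'I_n, (k <= i)%N -> coord c y i 0 = 0) <-> nP *m p = F p.
    apply: iff_trans (iff_sym (sliceP _ _)) _; rewrite cc /th Eth -/p.
    rewrite /nP mulmxBl mul1mx; split=> [->|<-]; first by rewrite opprB addrC subrK.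
    by rewrite opprB addrC subrK.
  apply: iff_trans (iff_sym Pc).
  have WP u : W u -> P *m u = u -> P *m (B *m tau u) = Phi u.
    move=> Wu Pu; rewrite /Phi Pu -[X in nP *m X]Pu mulmxA nPP mul0mx addr0.
    by [].
  split=> [/NP|pF].
    move=> /(_ d1) Py; set u := coord c1 y in Py Wy.
    have pu : p = B *m tau u by rewrite /p /tau /transition /u coordK.
    have su : s p = u.
      by rewrite /s pu WP//; have [] := hPhi u Wy.
    by rewrite /F su Py -pu.
  (* Both parts agree: the [P]-part by [PBs], the complementary one by the graph equation. Hence [y]
     is the point of N with [c1]-coordinate [s p]. *)
  have pE : p = B *m tau (s p).
    rewrite -[LHS](subrK (P *m p)) -{1}[p]mul1mx -mulmxBl pF /F sP//.
    by rewrite -PBs// -mulmxDl subrK mul1mx.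
  have Wsp := EW0 _ Ey.
  have [d1' d0' uE tE] := W0P _ Wsp.
  have cy : coord c0 y = coord c0 (pt c1 (s p)).
    have -> : coord c0 y = Q *m p by rewrite /p mulmxA QB mul1mx.
    by rewrite {1}pE mulmxA QB mul1mx tE.
  have -> : y = pt c1 (s p) by rewrite -(coordK d0) cy coordK.
  by apply/NP => //; rewrite uE sP.
Qed.

End AdaptedHolomorphic.

(** * Tangent spaces and isotropic submanifolds *)

Section Tangent.
Context (R : realType) (n : nat) (M : manifold R n).
Implicit Types (N : set M) (c : chart R n M).

(** The curve is the straight line in coordinates, restricted to a time interval on which it stays
    in the open set [codom c]. *)
Lemma tangent_affine N c x v : N x -> chart_at x c ->
  (forall t : R, codom c (coord c x + t *: v) -> N (pt c (coord c x + t *: v))) ->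
  tangent_space N c x v.
Proof.
move=> Nx [_ dx] H; pose gamma (t : R^o) := coord c x + t *: v.
have dg (t : R^o) : is_diff t gamma ( *:%R ^~ v).
  by rewrite -[X in is_diff _ _ X]add0r; exact: is_diffD.
have cg : {for (0 : R^o), continuous gamma}.
  by apply: differentiable_continuous; have [] := dg 0.
have g0 : gamma 0 = coord c x by rewrite /gamma scale0r addr0.
have /nbhs_ballP[e /= e0 He] : nbhs (0 : R^o) (gamma @^-1` codom c).
  apply: cg; rewrite g0; apply: open_nbhs_nbhs; split; first exact: coord_open.
  exact: codom_coord.
exists gamma, e => //; split=> //.
- have oB : open (ball (0 : R^o) e) by exact: ball_open.
  move=> k; apply: CkD => //; first exact: Ck_cst.
  have lin : linear (fun a : R^o => a *: v : 'cV[R]_n).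
    by move=> a b d; rewrite scalerDl scalerA.
  pose linM := GRing.isLinear.Build _ _ _ _ _ lin.
  pose L : {linear R^o -> 'cV[R]_n} :=
    HB.pack (fun a : R^o => a *: v : 'cV[R]_n) linM.
  by apply: (@Ck_linear _ _ _ _ _ L) => //; exact: scalel_continuous.
- by move=> t /He ct; split=> //; exact: H.
- by rewrite derive1E deriveE ?diff_val ?scale1r//; have [] := dg 0.
Qed.

Lemma tangent_space0 N c x : N x -> chart_at x c -> tangent_space N c x 0.
Proof.
move=> Nx cx; apply: tangent_affine => // t _.
by rewrite scaler0 addr0 coordK//; case: cx.
Qed.

Lemma tangent_slice N k c x v : N x -> chart_at x c -> adapted_chart N k c ->
  (pid_mx k : 'M[R]_n) *m v = v -> tangent_space N c x v.
Proof.
move=> Nx cx ad Pv; apply: tangent_affine => // t /ptK [dp pE].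
have [_ dx] := cx.
apply/(ad _ dp)/sliceP; rewrite pE mulmxDr -scalemxAr Pv.
by congr (_ + _); apply/sliceP/(ad _ dx).
Qed.

(** The form paired on [w] and [A w] is g(A w, A w), and the metric is positive definite. *)
Lemma fundamental_form_self (G A : components M) c x w : riemannian_metric G ->
  chart_at x c -> form (fundamental_form G A) c x w (A c x *m w) = 0 ->
  A c x *m w = 0.
Proof.
move=> [_ mG] cx H; apply/eqP; apply: contraT => Aw.
have [_ /(_ _ Aw)] := mG x c cx.
by move: H; rewrite /form /fundamental_form trmx_mul !mulmxA => ->; rewrite ltxx.
Qed.

(** Turns isotropy on the slice into the matrix equation of [lagrangian_invariant]: the entries of
    [P *m B c x *m P] are values of the form on projected basis vectors. *)
Lemma slice_form0 (k : nat) (B : components M) c x :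
  let P : 'M[R]_n := pid_mx k in
  (forall v w, P *m v = v -> P *m w = w -> form B c x v w = 0) ->
  P *m B c x *m P = 0.
Proof.
move=> P H; apply/matrixP => i j.
have PP : P *m P = P by exact: pid_mx_idem.
set X := P *m B c x *m P; pose e l : 'cV[R]_n := delta_mx l 0.
have -> : X i j = ((P *m e i)^T *m B c x *m (P *m e j)) 0 0.
  have -> : (P *m e i)^T *m B c x *m (P *m e j) =
      delta_mx 0 i *m X *m e j.
    by rewrite trmx_mul tr_pid_mx trmx_delta /X !mulmxA.
  by rewrite -rowE -colE [RHS]mxE [RHS]mxE.
by rewrite [RHS]mxE; apply: H; rewrite mulmxA PP.
Qed.

End Tangent.

(** * Real forms and complex submanifolds from isotropy *)

Section RealForms.
Context (R : realType) (n : nat) (M : hyperkahler R n) (N : set M) (k : nat).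

Lemma real_form_of_isotropic (A : components M) :
  submanifold N k -> half_dimensional n k ->
  (forall x c, N x -> chart_at x c -> forall v w,
    tangent_space N c x v -> tangent_space N c x w ->
    form (fundamental_form (hk_g M) A) c x v w = 0) ->
  real_form A N k.
Proof.
move=> sN hN iso; split=> // x c Nx cx; apply/seteqP; split=> [v|v ->].
  move=> [Tv [w Tw wv]]; rewrite /= -wv.
  apply: (fundamental_form_self (hk_metric M) cx).
  by rewrite wv; exact: iso Nx cx _ _ Tw Tv.
have T0 := tangent_space0 Nx cx.
by split=> //; exists 0 => //; rewrite mulmx0.
Qed.

Lemma isotropic_complex_submanifold : submanifold N k -> half_dimensional n k ->
  (forall x c, N x -> chart_at x c -> forall v w,
    tangent_space N c x v -> tangent_space N c x w ->
    form (@omega2 R n M) c x v w = 0 /\ form (@omega3 R n M) c x v w = 0) ->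
  complex_submanifold (hk_I M) N k.
Proof.
move=> sN hN iso; split=> // x Nx; have [kn sNx] := sN.
have [c1 [ac1 c1x] adc1] := sNx x Nx.
have [[[fI II] hI] _ _] := hk_kahlerI M.
have [[[_ JJ] _] _ _] := hk_kahlerJ M.
have [[[_ KK] _] _ _] := hk_kahlerK M.
have [c0 hc0 c0x] := hI x.
apply: (adapted_holomorphic_chart kn fI II Nx hc0 c0x ac1 c1x adc1) => y Ny c1y.
have cy : chart_at y c1 by [].
have T v := @tangent_slice _ _ M N k c1 y v Ny cy adc1.
have [_ mG] := hk_metric M.
have [_ Gpos] := mG y c1 cy.
apply: (@lagrangian_invariant R n k (hk_g M c1 y) _ (hk_J M c1 y)
  (hk_K M c1 y)) => //.
- exact: II.
- exact: JJ.
- exact: KK.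
- exact: hk_quaternionic.
- apply: (@slice_form0 _ _ M k (@omega2 R n M)) => v w /T Tv /T Tw.
  by have [] := iso y c1 Ny cy v w Tv Tw.
- apply: (@slice_form0 _ _ M k (@omega3 R n M)) => v w /T Tv /T Tw.
  by have [] := iso y c1 Ny cy v w Tv Tw.
Qed.

End RealForms.

Theorem proposition4p1 (R : realType) (n : nat) (M : hyperkahler R n)
    (N : set M) (k : nat) (hN : submanifold N k) :
  complex_lagrangian (hk_I M) (Omega1 M) N k <->
  imaginary_symplectic_form (hk_J M) (Omega2 M) N k /\
  real_symplectic_form (hk_K M) (Omega3 M) N k.
Proof.
(* Both directions pass through the vanishing of [omega2] and [omega3] on N: these are the two parts
   of [Omega1], the imaginary part of [Omega3] and the real part of [Omega2]. *)
split=> [[_ hd L]|[[[_ _ hd] im] [_ re]]].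
  have L2 x c (Nx : N x) (cx : chart_at x c) v w
      (Tv : tangent_space N c x v) (Tw : tangent_space N c x w) :
      form (@omega2 R n M) c x v w = 0.
    by have [] := L x c Nx cx v w Tv Tw.
  have L3 x c (Nx : N x) (cx : chart_at x c) v w
      (Tv : tangent_space N c x v) (Tw : tangent_space N c x w) :
      form (@omega3 R n M) c x v w = 0.
    by have [] := L x c Nx cx v w Tv Tw.
  by split; split=> //; exact: real_form_of_isotropic.
have L2 x c (Nx : N x) (cx : chart_at x c) v w
    (Tv : tangent_space N c x v) (Tw : tangent_space N c x w) :
    form (@omega2 R n M) c x v w = 0.
  exact: re Nx cx _ _ Tv Tw.
have L3 x c (Nx : N x) (cx : chart_at x c) v w
    (Tv : tangent_space N c x v) (Tw : tangent_space N c x w) :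
    form (@omega3 R n M) c x v w = 0.
  exact: im Nx cx _ _ Tv Tw.
split=> //.
  by apply: isotropic_complex_submanifold => // x c Nx cx v w Tv Tw; split; auto.
by move=> x c Nx cx v w Tv Tw; rewrite /Omega1 L2// L3.
Qed.
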